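(* Let $n\in\mathbb{N}$, $0\leq \gamma < \alpha < n$, $1<s<n/\alpha$ and $p \in [(n-\alpha s)/(n-\gamma s), +\infty)$. (i) If $p>\frac{n-\alpha s }{n-\gamma s }$, then there exists a constant $C=C(\alpha,\gamma,s,n,p)>0$ such that for every $f \in L^p(\mathrm{cap}_{\alpha,s})$ $$\int_{\mathbb{R}^{n}}\left(\mathcal{M}_{\mathrm{cap}_{\gamma,s}}f\right)^{p}d\mathrm{cap}_{\alpha,s} \leq C \int_{\mathbb{R}^{n}}|f|^p\,d\mathrm{cap}_{\alpha,s}.$$ (ii) If $p =\frac{n-\alpha s }{n-\gamma s }$, then there exists a constant $C=C(\alpha,\gamma,s,n)>0$ such that for every $f \in L^p(\mathrm{cap}_{\alpha,s})$ and every $t>0$ $$\mathrm{cap}_{\alpha,s}\left(\left\{x\in\mathbb{R}^{n}:\mathcal{M}_{\mathrm{cap}_{\gamma,s}}f(x)>t\right\}\right) \leq \frac{C}{t^{p}} \int_{\mathbb{R}^{n}}|f|^p\,d\mathrm{cap}_{\alpha,s}.$$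
   Context: For $\alpha\in(0,n)$ and $1<s<\infty$ the Riesz capacity of $E\subseteq\mathbb{R}^n$ is $\mathrm{cap}_{\alpha,s}(E)=\inf\{\|\varphi\|_{L^{s}(\mathbb{R}^{n})}^{s}:\varphi\geq 0,\ I_{\alpha}\ast\varphi\geq 1\text{ on }E\}$, where $I_{\alpha}(x)=\frac{1}{\gamma(\alpha)}\frac{1}{|x|^{n-\alpha}}$ is the Riesz kernel, with the usual normalization constant $\gamma(\alpha)=\pi^{n/2}2^{\alpha}\Gamma(\alpha/2)/\Gamma((n-\alpha)/2)$ (not to be confused with the parameter $\gamma$). For parameter $0$, $\mathrm{cap}_{0,s}$ is understood to be a positive constant multiple of (outer) Lebesgue measure, so that $\mathcal{M}_{\mathrm{cap}_{0,s}}$ is the centered Hardy–Littlewood maximal function $\sup_{r>0}\frac{1}{|B(x,r)|}\int_{B(x,r)}|f|\,dy$. For a $\mathrm{cap}_{\alpha,s}$-almost everywhere defined function $g$ with values in $[0,\infty]$, the Choquet integral is $\int_{\mathbb{R}^n} g \, d\mathrm{cap}_{\alpha,s} := \int_0^\infty \mathrm{cap}_{\alpha,s}(\{ g>t\})\,dt$, and $\int_A g\,d\mathrm{cap}_{\alpha,s}:=\int_{\mathbb{R}^n} g\chi_A\,d\mathrm{cap}_{\alpha,s}$ for $A\subseteq\mathbb{R}^n$ (and likewise for $\mathrm{cap}_{\gamma,s}$). A function $f$ (real-valued, defined $\mathrm{cap}_{\alpha,s}$-almost everywhere) is $\mathrm{cap}_{\alpha,s}$-quasicontinuous if for every $\varepsilon>0$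 there is an open set $O$ with $\mathrm{cap}_{\alpha,s}(O)<\varepsilon$ such that $f$ restricted to $\mathbb{R}^n\setminus O$ is continuous. For $0<p<\infty$, $L^p(\mathrm{cap}_{\alpha,s})$ is the set of $\mathrm{cap}_{\alpha,s}$-quasicontinuous functions $f$ with $(\int_{\mathbb{R}^n} |f|^p \, d \mathrm{cap}_{\alpha,s})^{1/p}<\infty$. The capacitary maximal function is $$\mathcal{M}_{\mathrm{cap}_{\gamma,s}}f(x)=\sup_{r>0}\frac{1}{\mathrm{cap}_{\gamma,s}(B(0,1))r^{n-\gamma s}}\int_{B(x,r)}|f|\,d\mathrm{cap}_{\gamma,s},$$ where $B(x,r)$ is the open ball with center $x$ and radius $r$. *)

(* Defs.v *)
From HB Require Import structures.
From mathcomp Require Import all_boot all_order all_algebra.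
From mathcomp Require Import all_classical all_reals all_analysis.

Set Implicit Arguments.
Unset Strict Implicit.
Unset Printing Implicit Defensive.

Import Order.TTheory GRing.Theory Num.Theory.
Import numFieldNormedType.Exports.

Local Open Scope classical_set_scope.
Local Open Scope ring_scope.

(* R^n is 'rV[R]_n with its library (product) topology.  Its sigma-algebra is
   the one generated by the coordinates, i.e. the product of the Borel
   sigma-algebras of the line. *)
Section row_measurable.
Context (R : realType) (n : nat).

Definition row_coord (i : 'I_n) (x : 'rV[R]_n) : measurableTypeR R := x 0 i.

Let row_set0 : g_sigma_preimage row_coord set0.
Proof. exact: sigma_algebra0. Qed.

Let row_setC A : g_sigma_preimage row_coord A ->
  g_sigma_preimage row_coord (~` A).
Proof. exact: sigma_algebraC. Qed.

Let row_bigcup (F : (set 'rV[R]_n)^nat) :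
  (forall i, g_sigma_preimage row_coord (F i)) ->
  g_sigma_preimage row_coord (\bigcup_i (F i)).
Proof. exact: sigma_algebra_bigcup. Qed.

HB.instance Definition _ := @isMeasurable.Build default_measure_display
  'rV[R]_n (g_sigma_preimage row_coord) row_set0 row_setC row_bigcup.

End row_measurable.

Section lebesgue_measure_row.
Context (R : realType).

Local Notation RT := (measurableTypeR R).

Definition pushforward_measure d d' (T1 : measurableType d)
    (T2 : measurableType d') (m : {measure set T1 -> \bar R}) (f : T1 -> T2)
    (mf : measurable_fun setT f) : {measure set T2 -> \bar R} :=
  measure_function_pushforward__canonical__measure_function_Measure m mf.

Definition tuple_cons n (z : n.-tuple RT * RT) : n.+1.-tuple RT :=
  [the n.+1.-tuple RT of z.2 :: z.1].

Lemma measurable_tuple_cons n : measurable_fun setT (@tuple_cons n).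
Proof.
exact: (@measurable_cons _ _ (n.-tuple RT * RT)%type RT snd n fst).
Qed.

Definition row_of_tuple n (t : n.-tuple RT) : 'rV[R]_n := \row_i tnth t i.

Lemma measurable_row_of_tuple n : measurable_fun setT (@row_of_tuple n).
Proof.
move=> _ A mA; rewrite setTI.
suff : preimage_set_system [set: n.-tuple RT] (@row_of_tuple n)
    (g_sigma_preimage (@row_coord R n)) (@row_of_tuple n @^-1` A).
  rewrite -g_sigma_preimage_comp.
  rewrite (_ : (fun i => row_coord i \o @row_of_tuple n) =
               (fun i (t : n.-tuple RT) => tnth t i))//.
  by apply/funext => i; apply/funext => t; rewrite /row_coord/= mxE.
by exists A => //; rewrite setTI.
Qed.

Fixpoint lebesgue_tuple n : {measure set (n.-tuple RT) -> \bar R} :=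
  match n with
  | 0 => dirac [tuple]
  | m.+1 => pushforward_measure (lebesgue_tuple m \x (@lebesgue_measure R))%E
              (@measurable_tuple_cons m)
  end.

Definition lebesgue_rV n : {measure set 'rV[R]_n -> \bar R} :=
  pushforward_measure (lebesgue_tuple n) (@measurable_row_of_tuple n).

Lemma lebesgue_tuple_box n (A : 'I_n -> set RT) :
  (forall i, measurable (A i)) ->
  (lebesgue_tuple n [set t | forall i, A i (tnth t i)] =
   \prod_(i < n) lebesgue_measure (A i))%E.
Proof.
elim: n A => [|n IH] A mA.
  by rewrite big_ord0 /= diracE mem_set//= => -[].
rewrite big_ord_recl /= /pushforward.
pose B := [set t : n.-tuple RT | forall i, A (lift ord0 i) (tnth t i)].
rewrite (_ : _ @^-1` _ = B `*` A ord0); last first.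
  apply/seteqP; split => [[t x]/= H|[t x]/= [H1 H2] i].
    split; last exact: (H ord0).
    by move=> i; have := H (lift ord0 i); rewrite /tuple_cons tnthS.
  by case: (unliftP ord0 i) => [j ->|->//]; rewrite /tuple_cons tnthS; exact: H1.
have mB : measurable B.
  rewrite (_ : B = \bigcap_(i in [set: 'I_n])
     ((fun t : n.-tuple RT => tnth t i) @^-1` A (lift ord0 i))); last first.
    by apply/seteqP; split => [t H i _|t H i]; exact: H.
  apply: fin_bigcap_measurable; [exact: finite_finset|].
  by move=> i _; rewrite -[X in measurable X]setTI; exact: measurable_tnth.
rewrite product_measure1E//= muleC; congr (_ * _)%E; exact: IH.
Qed.

(* Sanity check: the product formula on boxes, which characterises the
   measure. *)
Lemma lebesgue_rV_box n (A : 'I_n -> set RT) :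
  (forall i, measurable (A i)) ->
  (lebesgue_rV n [set x : 'rV[R]_n | forall i, A i (x ord0 i)] =
   \prod_(i < n) lebesgue_measure (A i))%E.
Proof.
move=> mA; rewrite -lebesgue_tuple_box//= /pushforward.
congr (lebesgue_tuple n _).
by apply/seteqP; split => t /= H i; move: (H i); rewrite mxE.
Qed.

End lebesgue_measure_row.

Section capacity.
Context (R : realType) (n : nat).
Implicit Types (x : 'rV[R]_n) (E O D : set 'rV[R]_n) (a s p : R).

(* The library norm on 'rV[R]_n is the sup norm. *)
Definition enorm x : R := Num.sqrt (\sum_(i < n) x 0 i ^+ 2).

Definition eball x (r : R) : set 'rV[R]_n := [set y | enorm (y - x) < r].

Definition Gamma_fun (z : R) : R :=
  (\int[lebesgue_measure]_(t in `]0, +oo[) (t `^ (z - 1) * expR (- t)))%R.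

Definition riesz_const a : R :=
  pi `^ (n%:R / 2) * 2 `^ a * Gamma_fun (a / 2) / Gamma_fun ((n%:R - a) / 2).

(* For a < n the inverse is taken in \bar R, so that the value at the origin is
   +oo. *)
Definition riesz_kernel a x : \bar R :=
  ((riesz_const a)^-1%:E * ((enorm x `^ (n%:R - a))%:E)^-1)%E.

Definition riesz_potential a (phi : 'rV[R]_n -> R) x : \bar R :=
  (\int[lebesgue_rV R n]_y (riesz_kernel a (x - y) * (phi y)%:E))%E.

Definition riesz_cap a s E : \bar R :=
  ereal_inf [set ('N[lebesgue_rV R n]_(s%:E) [EFin \o phi] `^ s)%E
            | phi in [set phi : 'rV[R]_n -> R |
                [/\ measurable_fun setT phi, forall x, 0 <= phi x &
                    forall x, E x -> (1 <= riesz_potential a phi x)%E]]].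

(* Order 0 is, by convention, c times the Lebesgue outer measure. *)
Definition cap (c : R) a s E : \bar R :=
  if a == 0 then (c%:E * (lebesgue_rV R n)^*%mu E)%E else riesz_cap a s E.

(* The Choquet integral of a function g that is defined on D only: the values
   of g outside D are never used. *)
Definition choquet (C : set 'rV[R]_n -> \bar R) D (g : 'rV[R]_n -> \bar R) :
    \bar R :=
  (\int[lebesgue_measure]_(t in `]0%R, +oo[) C [set x | D x /\ t%:E < g x])%E.

Definition choquet_on (C : set 'rV[R]_n -> \bar R) D (A : set 'rV[R]_n)
    (g : 'rV[R]_n -> \bar R) : \bar R :=
  choquet C D (fun x => g x * (\1_A x)%:E)%E.

(* A partially defined real function is a pair of a domain D and a total
   function f that is only considered on D. *)
Definition quasicontinuous (C : set 'rV[R]_n -> \bar R) D (f : 'rV[R]_n -> R) :=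
  C (~` D) = 0%E /\
  forall e : R, 0 < e -> exists O,
    [/\ open O, (C O < e%:E)%E & {within D `\` O, continuous f}].

Definition Lp_cap (C : set 'rV[R]_n -> \bar R) p D (f : 'rV[R]_n -> R) :=
  quasicontinuous C D f /\
  ((choquet C D (fun x => (`|f x| `^ p)%:E)) `^ p^-1 < +oo)%E.

Definition cap_maximal (c : R) a s D (f : 'rV[R]_n -> R) x : \bar R :=
  ereal_sup [set (choquet_on (cap c a s) D (eball x r) (fun y => `|f y|%:E)
                  / (cap c a s (eball 0 1) * (r `^ (n%:R - a * s))%:E))%E
            | r in [set r : R | 0 < r]].

End capacity.

(* Main.v *)
Require Import Defs.

(** Put [p0 = (n - alpha s) / (n - gamma s) < 1].  Only test functions are used,
    no capacitary measures.

    Isocapacitary inequality: [cap_gamma E <= C (int phi^s)^(1/p0)] as soon as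
    [I_alpha phi >= 1] on [E].  Choose the radius [r] so that
    [r^(n - alpha s)] is a large multiple of [int phi^s]; then the part of the
    potential coming from distances at least [r] is at most 1/2 everywhere, and
    the part coming from distances less than [r] is dominated by
    [C r^(alpha - gamma) I_gamma phi], or treated by Tonelli if [gamma = 0].

    Maximal function: let [lambda_j = l t 2^j] for a small constant [l], and let
    [phi_j] be almost optimal for [E_j = {|f| > lambda_j}].  If [M f x > t],
    realized on the ball [B] of radius [r] around [x], then, since the levels
    below [l t] contribute little,
    [t r^(n - gamma s) <= C sum_j lambda_j cap_gamma (E_j /\ B)].  Unless
    [I_alpha phi_j x >= c] for some [j], which happens on a set of small
    capacity, [2 phi_j] restricted to [2B] still tests [E_j /\ B] (Harnack), so
    the isocapacitary inequality and [1/p0 > 1] give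
    [t^p0 r^(n - alpha s) <= C int_(2B) sum_j lambda_j^p0 phi_j^s].
    The right-hand side is a measure of [2B], so Vitali's covering lemma yields
    [cap_alpha {M f > t} <= C sum_j 2^(j p0) cap_alpha {|f| > l t 2^j}],
    from which both claims follow by integrating over the level [t]. *)

From HB Require Import structures.
From mathcomp Require Import all_boot all_order all_algebra.
From mathcomp Require Import all_classical all_reals all_analysis.
From mathcomp Require Import measurable_realfun.
From mathcomp Require Import ring lra.

Set Implicit Arguments.
Unset Strict Implicit.
Unset Printing Implicit Defensive.

Import Order.TTheory GRing.Theory Num.Theory.
Import numFieldNormedType.Exports.

Local Open Scope classical_set_scope.
Local Open Scope ring_scope.

(** * Euclidean space and its Lebesgue measure *)

Section euclidean_space.
Context (R : realType) (n : nat).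
Local Notation V := 'rV[R]_n.
Local Notation mu := (lebesgue_rV R n).
Implicit Types (x y : V) (r : R).

Lemma ball_rowE x r : 0 < r ->
  ball x r = [set y : V | forall i, ball (x ord0 i) r (y ord0 i)].
Proof.
move=> r0; apply/seteqP; split => [y [_ H] i|y H]; first exact: H.
by split => // i j; rewrite (ord1 i); exact: H.
Qed.

Lemma ballN x y r : ball x r y <-> `|x - y| < r.
Proof. by rewrite -ball_normE. Qed.

Lemma measurable_row_coord i : measurable_fun [set: V] (fun x => x 0 i : R).
Proof.
move=> _ A mA; rewrite setTI; apply: sub_gen_smallest.
by rewrite (bigD1 i)//=; left; exists A; rewrite ?setTI.
Qed.

Lemma measurable_row_ball x r : measurable (ball x r : set V).
Proof.
have [r0|r0] := ltP 0 r; last first.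
  rewrite (_ : ball x r = set0)//; apply/seteqP; split => // y.
  by rewrite ballN => /(le_lt_trans (normr_ge0 _)); rewrite ltNge r0.
rewrite ball_rowE// (_ : mkset _ = \bigcap_(i in [set: 'I_n])
     ((fun y => y ord0 i) @^-1` ball (x ord0 i) r)); last first.
  by apply/seteqP; split => [y H i _|y H i]; [exact: H|exact: (H i I)].
apply: fin_bigcap_measurable; first exact: finite_finset.
move=> i _; rewrite -[X in measurable X]setTI.
by apply: measurable_row_coord => //; exact: measurable_ball.
Qed.

(** Sup-norm balls are boxes, so the product formula gives their measure exactly. The geometry below
    therefore uses [ball], and [enorm] is compared with the library norm at the cost of factors
    [sqrt n]. *)
Lemma lebesgue_ball x r : 0 < r -> mu (ball x r) = ((2 * r) ^+ n)%:E.
Proof.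
move=> r0; rewrite ball_rowE//.
have := @lebesgue_rV_box R n (fun i => ball (x ord0 i) r).
move=> ->; last by move=> i; exact: measurable_ball.
rewrite (eq_bigr (fun=> (2 * r)%:E)); last first.
  by move=> i _; rewrite lebesgue_measure_ball ?ltW// mulr_natl.
by rewrite prodEFin prodr_const card_ord.
Qed.

Lemma norm_le_enorm x : `|x| <= enorm x.
Proof.
rewrite /enorm [leLHS]/Num.norm/= mx_normrE; apply: bigmax_le => [|[i j] _ /=].
  exact: sqrtr_ge0.
rewrite (ord1 i) -sqrtr_sqr ler_sqrt; last by apply: sumr_ge0 => k _; exact: sqr_ge0.
by rewrite (bigD1 j)//= lerDl; apply: sumr_ge0 => k _; exact: sqr_ge0.
Qed.

Lemma coord_le_norm x i : `|x 0 i| <= `|x|.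
Proof.
rewrite [leRHS]/Num.norm/= mx_normrE.
exact: (le_bigmax _ (fun ij : 'I_1 * 'I_n => `|x ij.1 ij.2|) (0, i)).
Qed.

Lemma enorm_le_norm x : enorm x <= Num.sqrt n%:R * `|x|.
Proof.
rewrite -[X in _ * X]ger0_norm// -sqrtr_sqr -sqrtrM// ler_wsqrtr//.
rewrite (le_trans (ler_sum _ (G := fun=> `|x| ^+ 2) _))//.
  by move=> i _; rewrite -[leLHS]real_normK ?num_real// lerXn2r ?nnegrE ?coord_le_norm.
by rewrite sumr_const card_ord mulr_natl.
Qed.

Lemma enormN x : enorm (- x) = enorm x.
Proof. by congr Num.sqrt; apply: eq_bigr => i _; rewrite mxE sqrrN. Qed.

Lemma lebesgue_rV_sigma_finite : sigma_finite [set: V] mu.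
Proof.
exists (fun k : nat => ball (0 : V) k.+1%:R).
  apply/seteqP; split => // x _; exists (Num.truncn `|x|) => //=.
  by rewrite ballN sub0r normrN truncnS_gt.
move=> k; split; first exact: measurable_row_ball.
by rewrite lebesgue_ball// ltry.
Qed.

(* Sigma-finiteness can be declared for this function, not for the record
   [lebesgue_rV R n]; Tonelli's theorem needs it. *)
Definition lebesgue_row : set V -> \bar R := mu.

HB.instance Definition _ := Measure.copy lebesgue_row mu.

HB.instance Definition _ := @Measure_isSigmaFinite.Build _ _ _ lebesgue_row
  lebesgue_rV_sigma_finite.

Lemma integral_lebesgue_row (f : V -> \bar R) :
  (\int[lebesgue_row]_y f y = \int[mu]_y f y)%E.
Proof. exact: eq_measure_integral. Qed.

Lemma measurable_tonelli_row1 (f : V * V -> \bar R) :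
  (forall z, 0 <= f z)%E -> measurable_fun setT f ->
  measurable_fun setT (fun x => \int[mu]_y f (x, y))%E.
Proof.
move=> f0 mf; rewrite (_ : (fun _ => _) = fubini_F lebesgue_row f).
  exact: measurable_fun_fubini_tonelli_F.
by apply/funext => x; rewrite -integral_lebesgue_row.
Qed.

Lemma measurable_tonelli_row2 (f : V * V -> \bar R) :
  (forall z, 0 <= f z)%E -> measurable_fun setT f ->
  measurable_fun setT (fun y => \int[mu]_x f (x, y))%E.
Proof.
move=> f0 mf; rewrite (_ : (fun _ => _) = fubini_G lebesgue_row f).
  exact: measurable_fun_fubini_tonelli_G.
by apply/funext => x; rewrite -integral_lebesgue_row.
Qed.

Lemma tonelli_row (f : V * V -> \bar R) :
  (forall z, 0 <= f z)%E -> measurable_fun setT f ->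
  (\int[mu]_x \int[mu]_y f (x, y) = \int[mu]_y \int[mu]_x f (x, y))%E.
Proof.
move=> f0 mf; rewrite -!integral_lebesgue_row.
under eq_integral do rewrite -integral_lebesgue_row.
under [RHS]eq_integral do rewrite -integral_lebesgue_row.
exact: fubini_tonelli.
Qed.

(** Measurability is asked of each coordinate only, so that the lemma also covers [z.1 - z.2] on the
    product space. *)
Lemma measurable_enorm d (T : measurableType d) (f : T -> V) :
  (forall i, measurable_fun setT (fun t => f t 0 i : R)) ->
  measurable_fun setT (fun t => enorm (f t)).
Proof.
move=> mf; apply: (measurableT_comp (f := @Num.sqrt R)).
  by apply: continuous_measurable_fun; exact: sqrt_continuous.
by apply: measurable_sum => i; apply: measurable_funX.
Qed.

End euclidean_space.

(** * Dyadic sums and the Gamma function *)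

Section dyadic.
Context (R : realType).
Implicit Types (u r a q z : R).

Lemma dyadic_between u : 1 <= u -> exists j : nat, 2 ^+ j <= u < 2 ^+ j.+1.
Proof.
move=> u1; have u0 : 0 <= u by exact: le_trans u1.
have t0 : (0 < Num.truncn u)%N by rewrite truncn_gt0.
have /andP[j1 j2] := trunc_log_bounds (isT : (1 < 2)%N) t0.
exists (trunc_log 2 (Num.truncn u)); apply/andP; split.
  by rewrite -natrX -truncn_ge_nat.
by rewrite -natrX -truncn_lt_nat.
Qed.

Lemma dyadic_above r u : 0 < r -> r <= u ->
  exists j : nat, r * 2 ^+ j <= u < r * 2 ^+ j.+1.
Proof.
move=> r0 ru; have /dyadic_between[j] : 1 <= u / r by rewrite ler_pdivlMr// mul1r.
by rewrite ler_pdivlMr// ltr_pdivrMr// ![_ * r]mulrC; exists j.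
Qed.

Lemma dyadic_below r u : 0 < u -> u <= r ->
  exists j : nat, r / 2 ^+ j.+1 < u <= r / 2 ^+ j.
Proof.
move=> u0 ur; have /dyadic_between[j /andP[h1 h2]] : 1 <= r / u.
  by rewrite ler_pdivlMr// mul1r.
exists j; rewrite ltr_pdivrMr ?exprn_gt0// ler_pdivlMr ?exprn_gt0//.
by rewrite mulrC -ltr_pdivrMr// h2 mulrC -ler_pdivlMr.
Qed.

Lemma powRX u a j : 0 <= u -> (u ^+ j) `^ a = (u `^ a) ^+ j.
Proof. by move=> u0; rewrite -powR_mulrn// powRAC powR_mulrn// powR_ge0. Qed.

Lemma powR_inv2_lt1 z : 0 < z -> 2^-1 `^ z < 1 :> R.
Proof.
move=> z0; rewrite -[ltRHS](congr1 (@^~ z) (powR1 R)) gt0_ltr_powR ?nnegrE//.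
by rewrite invf_lt1 ?ltr1n.
Qed.

Lemma powR2_lt1 z : z < 0 -> 2 `^ z < 1 :> R.
Proof.
move=> z0; rewrite -(opprK z) powRN -powR_inv1 ?powR_ge0// -powRrM mulrC powRrM.
by rewrite powR_inv1// powR_inv2_lt1// oppr_gt0.
Qed.

Lemma nneseries_geometric a q : 0 <= a -> 0 <= q -> q < 1 ->
  (\sum_(j <oo) (a * q ^+ j)%:E)%E = (a / (1 - q))%:E.
Proof.
move=> a0 q0 q1; apply/cvg_lim => //.
rewrite (_ : (fun n => _) = EFin \o series (geometric a q)).
  by apply: cvg_EFin; [exact: nearW|apply: cvg_geometric_series; rewrite ger0_norm].
by apply/funext => n; rewrite /= /series/= sumEFin.
Qed.

Lemma nneseries_ge_term (u : (\bar R)^nat) j :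
  (forall k, 0 <= u k)%E -> (u j <= \sum_(k <oo) u k)%E.
Proof.
move=> u0; apply: le_trans (nneseries_lim_ge j.+1 _) => //.
by rewrite big_nat_recr//= leeDr// sume_ge0.
Qed.

(** On the dyadic interval []2^-(j+1), 2^-j]] the integrand is at most [2 * 2^j * 2^(-z j)];
    integrating this over []0, 2^-j]] leaves a geometric series of ratio [2^-z < 1]. *)
Lemma Gamma_integrand_near z : 0 < z ->
  (\int[lebesgue_measure]_(t in `]0%R, 1%R]) (t `^ (z - 1) * expR (- t))%:E
    < +oo)%E.
Proof.
move=> z0; pose g j (t : R) : \bar R := ((2 * 2 ^+ j * (2^-1 `^ z) ^+ j)%:E *
  (\1_(`]0%R, (2^-1 ^+ j)] : set R) t)%:E)%E.
have q0 : 0 <= 2^-1 `^ z :> R by exact: powR_ge0.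
have c0 j : 0 <= 2 * 2 ^+ j * (2^-1 `^ z) ^+ j :> R.
  by rewrite !mulr_ge0 ?exprn_ge0.
have q1 : 2^-1 `^ z < 1 :> R by exact: powR_inv2_lt1.
have g0 j t : (0 <= g j t)%E by rewrite mule_ge0 ?lee_fin.
have mg j : measurable_fun setT (g j).
  by apply/measurable_EFinP/measurable_funM => //; exact/measurable_indicP.
apply: (@le_lt_trans _ _ (\int[lebesgue_measure]_(t in `]0%R, 1%R])
    (\sum_(j <oo) g j t))%E).
  apply: ge0_le_integral => //.
  - by move=> t _; rewrite lee_fin mulr_ge0 ?powR_ge0 ?expR_ge0.
  - apply/measurable_EFinP/measurable_funM.
      exact: measurable_funTS (measurable_powR _).
    by apply: measurable_funTS; apply: measurableT_comp.
  - apply: ge0_emeasurable_sum => // j _; exact: measurable_funTS (mg j).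
  move=> t /=; rewrite in_itv/= => /andP[t0 t1].
  have [j /andP[j1 j2]] := dyadic_below t0 t1.
  apply: le_trans (nneseries_ge_term j _) => //.
  rewrite /g indicE mem_set/= ?in_itv/= ?t0 -?exprVn//= ?mule1; last first.
    by rewrite exprVn -[leRHS]mul1r.
  rewrite lee_fin -[leRHS]mulr1 ler_pM ?powR_ge0 ?expR_ge0//; last first.
    by rewrite -[leRHS]expR0 ler_expR oppr_le0 ltW.
  (* Writing the power as [t^z / t] avoids a case distinction on the sign of [z - 1]. *)
  rewrite powRB ?(gt_eqF t0) ?implybT// powRr1 ?(ltW t0)// -powRX// mulrC.
  rewrite ler_pM ?powR_ge0 ?invr_ge0 ?(ltW t0)//.
    by rewrite -exprS -[leRHS]invrK lef_pV2 ?posrE ?invr_gt0 ?exprn_gt0// -[leLHS]mul1r ltW.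
  by rewrite ge0_ler_powR ?nnegrE ?(ltW t0) ?(ltW z0)// exprVn -[leRHS]mul1r.
rewrite integral_nneseries//; last by move=> j; exact: measurable_funTS (mg j).
apply: (@le_lt_trans _ _ (\sum_(j <oo) (2 * (2^-1 `^ z) ^+ j)%:E)%E).
  apply: lee_nneseries => j _; first by move=> _; exact: integral_ge0.
  rewrite ge0_integralZl//; last first.
    by apply/measurable_funTS/measurable_EFinP/measurable_indicP.
  rewrite integral_indic//.
  apply: le_trans (lee_wpmul2l _ (le_measure _ _ _ (@subIsetl _ _ _))) _.
  - by rewrite lee_fin.
  - by rewrite inE; exact: measurableI.
  - by rewrite inE.
  set m := (X in (_ * X)%E); have -> : m = (2^-1 ^+ j)%:E.
    apply: etrans (lebesgue_measure_itv _) _.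
    by rewrite /= lte_fin exprn_gt0// sube0.
  rewrite -EFinM lee_fin.
  by rewrite mulrAC -(mulrA 2) -exprMn divff ?expr1n ?mulr1.

by rewrite nneseries_geometric// ltry.
Qed.

(** Half of the exponential decay absorbs the power, because [expR (t / 2)] dominates the term of
    degree [m + 1] of its series. The other half is, up to a factor 2, the density of an exponential
    law, whose integral is known. *)
Lemma powR_expR_bound z : exists2 C : R, 0 < C &
  forall t, 1 <= t -> t `^ (z - 1) * expR (- t) <= C * exponential_pdf 2^-1 t.
Proof.
pose m := (Num.truncn z).
exists (2 * (2 ^+ m.+1 * m.+1`!%:R)).
  by rewrite !mulr_gt0// ?exprn_gt0// ltr0n fact_gt0.
move=> t t1; have t0 : 0 <= t by exact: le_trans t1.
pose h := t / 2; have h0 : 0 <= h by rewrite divr_ge0.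
have K0 : 0 < (m.+1)`!%:R :> R by rewrite ltr0n fact_gt0.
have tm : t `^ (z - 1) <= 2 ^+ m.+1 * (m.+1)`!%:R * expR h.
  apply: (@le_trans _ _ (t ^+ m.+1)).
    rewrite -powR_mulrn// ler_powR// lerBlDr (le_trans (ltW (truncnS_gt z)))//.
    by rewrite -natr1 lerDr ler01 || rewrite lerDl.
  have -> : t = 2 * h by rewrite /h mulrC divfK.
  rewrite exprMn -mulrA ler_wpM2l ?exprn_ge0// -ler_pdivrMl// mulrC.
  by apply: le_trans (expR_ge1Dxn m h0); rewrite lerDr.
rewrite exponential_pdfE// [leRHS]mulrACA divff// mul1r.
have -> : - t = - h - h by rewrite /h; field.
have -> : - 2^-1 * t = - h by rewrite /h; field.
rewrite expRD mulrA ler_wpM2r ?expR_ge0// expRN ler_pdivrMr ?expR_gt0//.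
Qed.

Lemma Gamma_integral_far z :
  (\int[lebesgue_measure]_(t in `]1%R, +oo[) (t `^ (z - 1) * expR (- t))%:E
    < +oo)%E.
Proof.
have [C C0 HC] := powR_expR_bound z.
have half0 : 0 < 2^-1 :> R by [].
apply: (@le_lt_trans _ _ (\int[lebesgue_measure]_(t in `]1%R, +oo[)
  (C%:E * (exponential_pdf 2^-1 t)%:E))%E).
  apply: ge0_le_integral => //.
  - by move=> t _; rewrite lee_fin mulr_ge0 ?powR_ge0 ?expR_ge0.
  - apply/measurable_EFinP/measurable_funM.
      exact: measurable_funTS (measurable_powR _).
    by apply: measurable_funTS; apply: measurableT_comp.
  - apply/measurable_EFinP/measurable_funM => //.
    exact: measurable_funTS (measurable_exponential_pdf _).
  by move=> t /=; rewrite in_itv/= andbT => /ltW/HC; rewrite -EFinM lee_fin.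
apply: (@le_lt_trans _ _ (\int[lebesgue_measure]_t
  (C%:E * (exponential_pdf 2^-1 t)%:E))%E).
  apply: ge0_subset_integral => //.
    apply/measurable_EFinP/measurable_funM => //.
    exact: measurable_exponential_pdf.
  by move=> t _; rewrite -EFinM lee_fin mulr_ge0 ?(ltW C0)// exponential_pdf_ge0// ltW.
rewrite ge0_integralZl//.
- by rewrite integral_exponential_pdf// mule1 ltry.
- by apply/measurable_EFinP; exact: measurable_exponential_pdf.
- by move=> t _; rewrite lee_fin exponential_pdf_ge0// ltW.
- by rewrite lee_fin ltW.
Qed.

(** [Rintegral] is the finite part of an extended integral and would be 0 for an infinite one, so
    positivity also requires finiteness. *)
Lemma Gamma_fun_gt0 z : 0 < z -> 0 < Gamma_fun z.
Proof.
move=> z0; rewrite /Gamma_fun /Rintegral.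
have mf D : measurable_fun D (fun t : R => (t `^ (z - 1) * expR (- t))%:E).
  apply: measurable_funTS; apply/measurable_EFinP/measurable_funM.
    exact: measurable_powR.
  exact: measurableT_comp.
have f0 t : (0 <= (t `^ (z - 1) * expR (- t))%:E)%E.
  by rewrite lee_fin mulr_ge0 ?powR_ge0 ?expR_ge0.
apply: fine_gt0; apply/andP; split; last first.
  have -> : [set` `]0, +oo[] = [set` `]0, 1]] `|` [set` `]1, +oo[] :> set R.
    by rewrite -itv_bndbnd_setU// bnd_simp.
  rewrite ge0_integral_setU//=.
  - by rewrite lte_add_pinfty ?Gamma_integrand_near ?Gamma_integral_far.
  - exact: mf.
  - apply/disj_setPS => t [/=]; rewrite !in_itv/= andbT => /andP[_ t1].
    by rewrite ltNge t1.
(* On [[1, 2]] the integrand [t^z / t * expR (- t)] is at least [expR (- 2) / 2]. *)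
apply: (@lt_le_trans _ _ (\int[lebesgue_measure]_(t in `[1%R, 2%R])
    (cst (2^-1 * expR (- 2))%:E t))%E).
  rewrite integral_cst//= lebesgue_measure_itv/= lte_fin ltr1n -EFinB -EFinM.
  by rewrite lte_fin !mulr_gt0// ?expR_gt0// subr_gt0 ltr1n.
apply: (@le_trans _ _ (\int[lebesgue_measure]_(t in `[1%R, 2%R])
    ((t `^ (z - 1) * expR (- t))%:E))%E).
  apply: ge0_le_integral => //.
  - by move=> t _; rewrite lee_fin mulr_ge0// expR_ge0.
  - exact: mf.
  move=> t /=; rewrite in_itv/= => /andP[t1 t2].
  have t0 : 0 < t by exact: lt_le_trans t1.
  rewrite lee_fin ler_pM ?expR_ge0//; last by rewrite ler_expR lerN2.
  rewrite powRB ?(gt_eqF t0) ?implybT// powRr1 ?(ltW t0)//.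
  rewrite -[leLHS]mul1r ler_pM ?invr_ge0//; last by rewrite lef_pV2 ?posrE.
  by rewrite -[leLHS](congr1 (@^~ z) (powR1 R)) ge0_ler_powR ?nnegrE ?(ltW z0) ?(ltW t0).
apply: ge0_subset_integral => //; first exact: mf.
move=> t/=; rewrite !in_itv/= andbT => /andP[t1 _]; exact: lt_le_trans t1.
Qed.

Lemma riesz_const_gt0 (n : nat) a : 0 < a -> a < n%:R -> 0 < riesz_const n a.
Proof.
move=> a0 an; rewrite /riesz_const divr_gt0 ?mulr_gt0 ?Gamma_fun_gt0 ?powR_gt0//.
- exact: pi_gt0.
- by rewrite divr_gt0.
- by rewrite divr_gt0// subr_gt0.
Qed.

End dyadic.

(** * The Riesz kernel and its potentials *)

Section riesz_kernel.
Context (R : realType) (n : nat).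
Local Notation V := 'rV[R]_n.
Implicit Types (x y w : V) (a g r : R).

Lemma riesz_kernelN a w : riesz_kernel a (- w) = riesz_kernel a w.
Proof. by rewrite /riesz_kernel enormN. Qed.

Lemma enorm_ge0 w : 0 <= enorm w. Proof. exact: sqrtr_ge0. Qed.

(** Because [n - a] is nonzero, the power vanishes at the origin and its inverse in [\bar R] is
    infinite. Several comparisons below therefore treat the diagonal apart. *)
Lemma riesz_kernel0 a : 0 < a -> a < n%:R -> riesz_kernel a (0 : V) = +oo%E.
Proof.
move=> a0 an; rewrite /riesz_kernel.
have -> : enorm (0 : V) = 0.
  by apply/eqP; rewrite eq_le enorm_ge0 andbT (le_trans (enorm_le_norm _))// normr0 mulr0.
rewrite powR0 ?subr_eq0 ?gt_eqF// inve0 gt0_muley//.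
by rewrite lte_fin invr_gt0 riesz_const_gt0.
Qed.

Lemma riesz_kernel_neq0 a w : w != 0 ->
  riesz_kernel a w = ((riesz_const n a)^-1 * enorm w `^ (a - n%:R))%:E.
Proof.
move=> w0; have e0 : 0 < enorm w by rewrite (lt_le_trans _ (norm_le_enorm w))// normr_gt0.
by rewrite /riesz_kernel inver gt_eqF ?powR_gt0// -powRN opprB EFinM.
Qed.

Lemma riesz_kernel_ge0 a w : 0 < a -> a < n%:R -> (0 <= riesz_kernel a w)%E.
Proof.
move=> a0 an; rewrite mule_ge0 ?inve_ge0 ?lee_fin ?powR_ge0//.
by rewrite invr_ge0 ltW// riesz_const_gt0.
Qed.

Lemma measurable_riesz_kernel d (T : measurableType d) (f : T -> V) a :
  (forall i, measurable_fun setT (fun t => f t 0 i : R)) ->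
  measurable_fun setT (fun t => riesz_kernel a (f t)).
Proof.
move=> mf; apply: measurable_funeM.
have mp : measurable_fun setT (fun t => enorm (f t) `^ (n%:R - a)).
  apply: (measurableT_comp (measurable_powR _)); exact: measurable_enorm.
rewrite (_ : (fun _ => _) = fun t => if enorm (f t) `^ (n%:R - a) == 0 then +oo%E
  else (enorm (f t) `^ (- (n%:R - a)))%:E); last first.
  by apply/funext => t; rewrite inver powRN.
apply: measurable_fun_ifT => //.
  exact: measurable_fun_eqr.
apply/measurable_EFinP; apply: (measurableT_comp (measurable_powR _)).
exact: measurable_enorm.
Qed.

Lemma ler_npowR (u v b : R) : b <= 0 -> 0 < u -> u <= v -> v `^ b <= u `^ b.
Proof.
move=> b0 u0 uv; have v0 : 0 < v by exact: lt_le_trans uv.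
rewrite -(opprK b) !(powRN _ (- b)) lef_pV2 ?posrE ?powR_gt0//.
by rewrite ge0_ler_powR ?nnegrE ?oppr_ge0// ltW.
Qed.

Lemma riesz_kernel_le a w r : 0 < a -> a < n%:R -> 0 < r -> r <= `|w| ->
  (riesz_kernel a w <= ((riesz_const n a)^-1 * r `^ (a - n%:R))%:E)%E.
Proof.
move=> a0 an r0 rw; rewrite riesz_kernel_neq0; last first.
  by rewrite -normr_gt0; exact: lt_le_trans rw.
rewrite lee_fin ler_wpM2l ?invr_ge0 ?(ltW (riesz_const_gt0 a0 an))// ?ler_npowR//.
  by rewrite subr_le0 ltW.
by rewrite (le_trans rw)// norm_le_enorm.
Qed.

Lemma riesz_kernel_ge a w r : 0 < a -> a < n%:R -> 0 < r -> `|w| <= r ->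
  (((riesz_const n a)^-1 * (Num.sqrt n%:R * r) `^ (a - n%:R))%:E
    <= riesz_kernel a w)%E.
Proof.
move=> a0 an r0 rw; have [->|w0] := eqVneq w 0; first by rewrite riesz_kernel0// leey.
rewrite riesz_kernel_neq0//.
rewrite lee_fin ler_wpM2l ?invr_ge0 ?(ltW (riesz_const_gt0 a0 an))// ?ler_npowR//.
- by rewrite subr_le0 ltW.
- by rewrite (lt_le_trans _ (norm_le_enorm w))// normr_gt0.
- by rewrite (le_trans (enorm_le_norm w))// ler_wpM2l// sqrtr_ge0.
Qed.

(** This Harnack comparison serves to move the base point of a potential; the factor [sqrt n] pays
    for the passage between the two norms. *)
Lemma riesz_kernel_le_scale a w w' r : 0 < a -> a < n%:R -> 0 < r ->
  `|w| <= r * `|w'| ->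
  (riesz_kernel a w' <=
    ((Num.sqrt n%:R * r) `^ (n%:R - a))%:E * riesz_kernel a w)%E.
Proof.
move=> a0 an r0 ww'.
have n0 : 0 < n%:R :> R by exact: lt_trans an.
have c0 : 0 < Num.sqrt n%:R * r by rewrite mulr_gt0// sqrtr_gt0.
have [->|w0] := eqVneq w 0.
  by rewrite riesz_kernel0// gt0_muley ?leey// lte_fin powR_gt0.
have w'0 : w' != 0.
  rewrite -normr_gt0 -(pmulr_rgt0 _ r0); apply: lt_le_trans ww'.
  by rewrite normr_gt0.
rewrite !riesz_kernel_neq0// lee_fin mulrCA ler_wpM2l//.
  by rewrite invr_ge0 ltW// riesz_const_gt0.
have e0 : 0 < enorm w' by rewrite (lt_le_trans _ (norm_le_enorm w'))// normr_gt0.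
have e1 : 0 < enorm w by rewrite (lt_le_trans _ (norm_le_enorm w))// normr_gt0.
have ee : enorm w <= Num.sqrt n%:R * r * enorm w'.
  rewrite (le_trans (enorm_le_norm w))// -mulrA ler_wpM2l ?sqrtr_ge0//.
  by rewrite (le_trans ww')// ler_wpM2l ?norm_le_enorm// ltW.
rewrite -(opprB a) powRN ler_pdivlMl ?powR_gt0// -powRM ?(ltW c0) ?(ltW e0)//.
by apply: ler_npowR => //; rewrite subr_le0 ltW.
Qed.

(** The quotient of the two kernels is a constant times [enorm w ^ (a - g)], a nonnegative power,
    hence largest at the maximal distance. *)
Lemma riesz_kernel_order g a w r : 0 < g -> g <= a -> a < n%:R -> 0 < r ->
  `|w| <= r ->
  (riesz_kernel a w <= ((riesz_const n g / riesz_const n a) *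
     (Num.sqrt n%:R * r) `^ (a - g))%:E * riesz_kernel g w)%E.
Proof.
move=> g0 ga an r0 wr.
have a0 : 0 < a by exact: lt_le_trans ga.
have gn : g < n%:R by exact: le_lt_trans an.
have n0 : 0 < n%:R :> R by exact: lt_trans an.
have ka := riesz_const_gt0 a0 an; have kg := riesz_const_gt0 g0 gn.
have c0 : 0 < Num.sqrt n%:R * r by rewrite mulr_gt0// sqrtr_gt0.
have [->|w0] := eqVneq w 0.
  rewrite [X in (_ <= _ * X)%E]riesz_kernel0//.
  rewrite gt0_muley ?leey// lte_fin.
  exact: mulr_gt0 (divr_gt0 kg ka) (powR_gt0 _ c0).
have e1 : 0 < enorm w by rewrite (lt_le_trans _ (norm_le_enorm w))// normr_gt0.
rewrite !riesz_kernel_neq0// lee_fin.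
move: (riesz_const n g) (riesz_const n a) kg ka => cg ca kg ka.
have -> : a - n%:R = (a - g) + (g - n%:R) by ring.
rewrite powRD ?(gt_eqF e1) ?implybT//.
have -> : cg / ca * (Num.sqrt n%:R * r) `^ (a - g) *
  ((cg)^-1 * enorm w `^ (g - n%:R)) =
  (ca)^-1 * ((Num.sqrt n%:R * r) `^ (a - g) * enorm w `^ (g - n%:R)).
  by field; rewrite !gt_eqF.
rewrite ler_wpM2l ?invr_ge0 ?(ltW ka)// ler_wpM2r ?powR_ge0//.
rewrite ge0_ler_powR ?subr_ge0 ?nnegrE ?(ltW e1) ?(ltW c0)//.
by rewrite (le_trans (enorm_le_norm w))// ler_wpM2l// sqrtr_ge0.
Qed.

End riesz_kernel.

(** * Truncation and dyadic shells *)

Section potential_estimates.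
Context (R : realType) (n : nat).
Local Notation V := 'rV[R]_n.
Local Notation mu := (lebesgue_rV R n).
Implicit Types (x y w : V) (a g r s : R).

Lemma nneseries_ge_cst (u : (\bar R)^nat) (e : R) : 0 < e ->
  (forall j, e%:E <= u j)%E -> (\sum_(j <oo) u j = +oo)%E.
Proof.
move=> e0 eu; apply: eq_infty => A.
have u0 j : (0 <= u j)%E by rewrite (le_trans _ (eu j))// lee_fin ltW.
pose m := (Num.truncn (A / e)).+1.
apply: le_trans (nneseries_lim_ge m _) => //.
apply: (@le_trans _ _ (\sum_(0 <= i < m) e%:E)%E); last exact: lee_sum.
rewrite sumEFin lee_fin sumr_const_nat subn0 -mulr_natl -ler_pdivrMr//.
exact: ltW (truncnS_gt _).
Qed.

(** If [u > h] then [u = u^(1-s) u^s <= h^(1-s) u^s]. This pointwise bound takes the place of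
    Hoelder's inequality; the level [h] is adapted to the scale at each use. *)
Lemma ler_truncation (h u s : R) : 0 < h -> 0 <= u -> 1 < s ->
  u <= h + h `^ (1 - s) * u `^ s.
Proof.
move=> h0 u0 s1; have [uh|hu] := leP u h.
  by rewrite (le_trans uh)// lerDl mulr_ge0 ?powR_ge0.
have u1 : 0 < u by exact: lt_trans hu.
rewrite -[leLHS](powRr1 u0) -[X in _ `^ X](subrK s) powRD ?(gt_eqF u1) ?implybT//.
rewrite (@le_trans _ _ (h `^ (1 - s) * u `^ s))// ?lerDr ?(ltW h0)//.
rewrite ler_wpM2r ?powR_ge0// ler_npowR ?(ltW hu)//.
by rewrite subr_le0 ltW.
Qed.

Lemma measurable_indic_row (A : set V) : measurable A ->
  measurable_fun setT (fun y => (\1_A y : R)%:E).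
Proof. by move=> mA; apply/measurable_EFinP; exact/measurable_indicP. Qed.

Lemma measurable_kernel_sub a x : measurable_fun setT (fun y => riesz_kernel a (x - y)).
Proof.
apply: measurable_riesz_kernel => i.
rewrite (_ : (fun _ => _) = fun y => x 0 i - y 0 i); last first.
  by apply/funext => y; rewrite !mxE.
by apply: measurable_funB => //; exact: measurable_row_coord.
Qed.

(** One term suffices, that of the shell which contains [y]. The shells are closed on the outside
    while balls are open, whence the doubled radius in the indicator. *)
Lemma riesz_kernel_near_shells a x y r : 0 < a -> a < n%:R -> 0 < r ->
  ball x r y ->
  (riesz_kernel a (x - y) <= \sum_(j <oo)
    (((riesz_const n a)^-1 * (r / 2 ^+ j.+1) `^ (a - n%:R))%:E *
     (\1_(ball x (2 * (r / 2 ^+ j)) : set V) y)%:E))%E.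
Proof.
move=> a0 an r0; rewrite ballN => xyr.
have k0 : 0 < (riesz_const n a)^-1 by rewrite invr_gt0 riesz_const_gt0.
set u := (X in (\sum_(j <oo) X j)%E).
have u0 j : (0 <= u j)%E.
  by rewrite /u mule_ge0 ?lee_fin// mulr_ge0 ?powR_ge0// ltW.
have [xy|xy] := eqVneq (x - y) 0.
  (* On the diagonal the kernel is infinite; all terms are bounded below by the same positive
     constant, so the series is infinite as well. *)
  rewrite (@nneseries_ge_cst _ ((riesz_const n a)^-1 * r `^ (a - n%:R))) ?leey//.
    by rewrite mulr_gt0// powR_gt0.
  move=> j; rewrite /u indicE mem_set ?mule1; last first.
    by rewrite ballN xy normr0 mulr_gt0// divr_gt0// exprn_gt0.
  rewrite lee_fin ler_wpM2l ?(ltW k0)// ler_npowR//.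
  - by rewrite subr_le0 ltW.
  - by rewrite divr_gt0// exprn_gt0.
  - by rewrite ler_pdivrMr ?exprn_gt0// ler_peMr ?(ltW r0)// exprn_ege1// ler1n.
have n0 : 0 < `|x - y| by rewrite normr_gt0.
have [j /andP[j1 j2]] := dyadic_below n0 (ltW xyr).
apply: le_trans (nneseries_ge_term j u0).
rewrite /u indicE mem_set ?mule1; last first.
  by rewrite ballN (le_lt_trans j2)// ltr_pMl ?ltr1n// divr_gt0// exprn_gt0.
by rewrite riesz_kernel_le ?(ltW j1)// divr_gt0// exprn_gt0.
Qed.

Lemma riesz_kernel_far_shells a x y r : 0 < a -> a < n%:R -> 0 < r ->
  ~ ball x r y ->
  (riesz_kernel a (x - y) <= \sum_(j <oo)
    (((riesz_const n a)^-1 * (r * 2 ^+ j) `^ (a - n%:R))%:E *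
     (\1_(ball x (r * 2 ^+ j.+1) : set V) y)%:E))%E.
Proof.
move=> a0 an r0; rewrite ballN => /negP; rewrite -leNgt => xyr.
have k0 : 0 < (riesz_const n a)^-1 by rewrite invr_gt0 riesz_const_gt0.
set u := (X in (\sum_(j <oo) X j)%E).
have u0 j : (0 <= u j)%E.
  by rewrite /u mule_ge0 ?lee_fin// mulr_ge0 ?powR_ge0// ltW.
have [j /andP[j1 j2]] := dyadic_above r0 xyr.
apply: le_trans (nneseries_ge_term j u0).
rewrite /u indicE mem_set ?mule1; last by rewrite ballN.
by rewrite riesz_kernel_le// mulr_gt0// exprn_gt0.
Qed.

(** Each shell contributes a kernel bound of order [(r 2^-j)^(a - n)] times a volume of order
    [(r 2^-j)^n], that is [r^a 2^(- a j)] up to a constant. *)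
Lemma integral_riesz_kernel_ball a : 0 < a -> a < n%:R ->
  exists2 C : R, 0 < C & forall x r, 0 < r ->
  (\int[mu]_(y in ball x r) riesz_kernel a (x - y) <= (C * r `^ a)%:E)%E.
Proof.
move=> a0 an.
have k0 : 0 < (riesz_const n a)^-1 by rewrite invr_gt0 riesz_const_gt0.
pose q := 2^-1 `^ a : R.
pose K := (riesz_const n a)^-1 * 2^-1 `^ (a - n%:R) * 4 ^+ n.
have q1 : q < 1 by exact: powR_inv2_lt1.
have K0 : 0 < K by rewrite !mulr_gt0 ?exprn_gt0 ?powR_gt0.
exists (K / (1 - q)); first by rewrite divr_gt0// subr_gt0.
move=> x r r0.
pose g j y := (((riesz_const n a)^-1 * (r / 2 ^+ j.+1) `^ (a - n%:R))%:E *
     (\1_(ball x (2 * (r / 2 ^+ j)) : set V) y)%:E)%E.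
have g0 j y : (0 <= g j y)%E.
  by rewrite mule_ge0 ?lee_fin// mulr_ge0 ?powR_ge0// ltW.
have mB j : measurable (ball x (2 * (r / 2 ^+ j)) : set V).
  exact: measurable_row_ball.
have mg j : measurable_fun setT (g j).
  by apply: measurable_funeM; exact: measurable_indic_row.
apply: (@le_trans _ _ (\int[mu]_(y in ball x r) (\sum_(j <oo) g j y))%E).
  apply: ge0_le_integral => //.
  - exact: measurable_row_ball.
  - by move=> y _; exact: riesz_kernel_ge0.
  - exact: measurable_funTS (measurable_kernel_sub a x).
  - by apply: ge0_emeasurable_sum => // j _; exact: measurable_funTS (mg j).
  - by move=> y xy; exact: riesz_kernel_near_shells.
apply: (@le_trans _ _ (\int[mu]_y (\sum_(j <oo) g j y))%E).
  apply: ge0_subset_integral => //; first exact: measurable_row_ball.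
    by apply: ge0_emeasurable_sum.
  by move=> y _; exact: nneseries_ge0.
rewrite integral_nneseries//.
rewrite (eq_eseriesr (g := fun j => (K * r `^ a * q ^+ j)%:E)).
  rewrite nneseries_geometric ?powR_ge0 ?mulr_ge0 ?powR_ge0 ?(ltW K0) ?(ltW k0)//.
  by rewrite lee_fin mulrAC.
move=> j _; rewrite /g ge0_integralZl//; last first.
- by rewrite lee_fin mulr_ge0 ?powR_ge0// ltW.
- exact: measurable_indic_row.
have rj : 0 < r / 2 ^+ j by rewrite divr_gt0// exprn_gt0.
rewrite integral_indic// setIT lebesgue_ball ?mulr_gt0// -EFinM; congr EFin.
rewrite -!exprVn exprS mulrCA powRM ?invr_ge0 ?mulr_ge0 ?exprn_ge0 ?(ltW r0)//.
rewrite powRM ?exprn_ge0 ?(ltW r0)// powRX//.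
have -> : 2 * (2 * (r * 2^-1 ^+ j)) = 4 * (r * 2^-1 ^+ j) by ring.
rewrite !exprMn.
rewrite -(powR_mulrn n (ltW r0)) -(powR_mulrn n (exprn_ge0 j _)) ?powRX//.
have -> : q = 2^-1 `^ (a - n%:R) * 2^-1 `^ n%:R.
  by rewrite -powRD ?invr_eq0 ?pnatr_eq0 ?implybT// subrK.
have -> : r `^ a = r `^ (a - n%:R) * r `^ n%:R.
  by rewrite -powRD ?(gt_eqF r0) ?implybT// subrK.
rewrite exprMn /K; ring.
Qed.

Lemma integral_trunc_le (D : set V) (phi : V -> R) s h (X : \bar R) :
  measurable D -> measurable_fun setT phi -> (forall y, 0 <= phi y) ->
  0 < h -> 1 < s ->
  (\int[mu]_y (phi y `^ s)%:E <= X)%E ->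
  (\int[mu]_(y in D) (phi y)%:E <= h%:E * mu D + (h `^ (1 - s))%:E * X)%E.
Proof.
move=> mD mphi phi0 h0 s1 phiX.
have mps : measurable_fun setT (fun y => phi y `^ s).
  exact: (measurableT_comp (measurable_powR _)).
have hs0 : 0 <= h `^ (1 - s) by exact: powR_ge0.
apply: (@le_trans _ _ (\int[mu]_(y in D)
   (h%:E + (h `^ (1 - s))%:E * (phi y `^ s)%:E))%E).
  apply: ge0_le_integral => //.
  - by move=> y _; rewrite lee_fin.
  - by apply/measurable_funTS/measurable_EFinP.
  - apply/measurable_funTS/measurable_EFinP/measurable_funD => //.
    by apply: measurable_funM.
  - by move=> y _; rewrite -EFinM -EFinD lee_fin; exact: ler_truncation.
rewrite ge0_integralD//; last 3 first.
- by move=> y _; rewrite lee_fin ltW.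
- by move=> y _; rewrite -EFinM lee_fin mulr_ge0 ?powR_ge0.
- by apply/measurable_funTS/measurable_EFinP/measurable_funM.
rewrite integral_cst// leeD2l// ge0_integralZl//; last 2 first.
- by apply/measurable_funTS/measurable_EFinP.
- by move=> y _; rewrite lee_fin powR_ge0.
rewrite lee_wpmul2l ?lee_fin//; apply: le_trans phiX.
apply: ge0_subset_integral => //; first exact/measurable_EFinP.
by move=> y _; rewrite lee_fin powR_ge0.
Qed.

End potential_estimates.

(** * The contribution of distant points to a potential *)

Section far_potential.
Context (R : realType) (n : nat).
Local Notation V := 'rV[R]_n.
Local Notation mu := (lebesgue_rV R n).
Implicit Types (x y w : V) (a g r s : R).

Lemma measurable_potential (phi : V -> R) a x : measurable_fun setT phi ->
  measurable_fun setT (fun y => (riesz_kernel a (x - y) * (phi y)%:E)%E).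
Proof.
move=> mphi; apply: emeasurable_funM; first exact: measurable_kernel_sub.
exact/measurable_EFinP.
Qed.

(** This is the contribution of a shell of radius [r T], truncated at the level [e r^(-a) T^(-n/s)].
    The exponents of this level are chosen so that both terms decay like [T^(a - n/s)]. *)
Lemma far_shell_identity (r T e a s X : R) : 0 < r -> 0 < T -> 0 < e -> 0 < s ->
  (r * T) `^ (a - n%:R) * (e * r `^ (- a) * T `^ (- (n%:R / s)) * (4 * r * T) ^+ n
    + (e * r `^ (- a) * T `^ (- (n%:R / s))) `^ (1 - s) * X) =
  (4 ^+ n * e + e `^ (1 - s) * r `^ (a * s - n%:R) * X) * T `^ (a - n%:R / s).
Proof.
move=> r0 T0 e0 s0.
have [r1 T1] : r != 0 /\ T != 0 by rewrite !gt_eqF.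
have pD u b c : u != 0 -> u `^ b * u `^ c = u `^ (b + c).
  by move=> u0; rewrite powRD ?u0 ?implybT.
rewrite (powRM _ (ltW r0) (ltW T0)) !exprMn.
rewrite -(powR_mulrn n (ltW r0)) -(powR_mulrn n (ltW T0)).
rewrite (powRM (1 - s)) ?mulr_ge0 ?powR_ge0 ?(ltW e0)//.
rewrite (powRM (1 - s)) ?powR_ge0 ?(ltW e0)// -!powRrM.
transitivity (4 ^+ n * e * (r `^ (a - n%:R) * r `^ (- a) * r `^ n%:R) *
    (T `^ (a - n%:R) * T `^ (- (n%:R / s)) * T `^ n%:R) +
  e `^ (1 - s) * X * (r `^ (a - n%:R) * r `^ (- a * (1 - s))) *
    (T `^ (a - n%:R) * T `^ (- (n%:R / s) * (1 - s)))); first by ring.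
rewrite !pD//.
have -> : a - n%:R - a + n%:R = 0 by ring.
have -> : a - n%:R - n%:R / s + n%:R = a - n%:R / s by ring.
have -> : a - n%:R + - a * (1 - s) = a * s - n%:R by ring.
have -> : a - n%:R + - (n%:R / s) * (1 - s) = a - n%:R / s by field; rewrite gt_eqF.
by rewrite powRr0; ring.
Qed.

(* Summing over dyadic shells converges because [a - n / s < 0]. *)
Lemma far_potential_le a s : 0 < a -> a < n%:R -> 1 < s -> a * s < n%:R ->
  exists2 C : R, 0 < C & forall (phi : V -> R) (X e r : R) x,
  measurable_fun setT phi -> (forall y, 0 <= phi y) ->
  (\int[mu]_y (phi y `^ s)%:E <= X%:E)%E -> 0 <= X -> 0 < e -> 0 < r ->
  (\int[mu]_(y in ~` ball x r) (riesz_kernel a (x - y) * (phi y)%:E) <=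
     (C * (e + e `^ (1 - s) * r `^ (a * s - n%:R) * X))%:E)%E.
Proof.
move=> a0 an s1 asn; have s0 : 0 < s by exact: lt_trans s1.
have k0 : 0 < (riesz_const n a)^-1 by rewrite invr_gt0 riesz_const_gt0.
set k := (riesz_const n a)^-1 in k0 *.
pose q := 2 `^ (a - n%:R / s) : R.
have q0 : 0 < q by exact: powR_gt0.
have q1 : q < 1 by rewrite powR2_lt1// subr_lt0 ltr_pdivlMr.
have q'0 : 0 < 1 - q by rewrite subr_gt0.
exists (k * 4 ^+ n / (1 - q)); first by rewrite divr_gt0// mulr_gt0// exprn_gt0.
move=> phi X e r x mphi phi0 phiX X0 e0 r0.
pose c j := k * (r * 2 ^+ j) `^ (a - n%:R).
pose B j := ball x (r * 2 ^+ j.+1) : set V.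
have c0 j : 0 <= c j by rewrite mulr_ge0 ?powR_ge0// ltW.
have mB j : measurable (B j) by exact: measurable_row_ball.
have mf : measurable_fun setT (fun y => (phi y)%:E) by exact/measurable_EFinP.
pose g j y := ((c j)%:E * ((\1_(B j) y)%:E * (phi y)%:E))%E.
have g0 j y : (0 <= g j y)%E by rewrite !mule_ge0 ?lee_fin.
have mg j : measurable_fun setT (g j).
  by apply/measurable_funeM/emeasurable_funM => //; exact: measurable_indic_row.
apply: (@le_trans _ _ (\int[mu]_(y in ~` ball x r) (\sum_(j <oo) g j y))%E).
  apply: ge0_le_integral => //.
  - by apply: measurableC; exact: measurable_row_ball.
  - by move=> y _; rewrite mule_ge0 ?lee_fin ?riesz_kernel_ge0.
  - exact: measurable_funTS (measurable_potential _ _ mphi).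
  - by apply: ge0_emeasurable_sum => // j _; exact: measurable_funTS (mg j).
  move=> y xy; rewrite /g (eq_eseriesr (g := fun j => ((phi y)%:E *
    ((c j)%:E * (\1_(B j) y)%:E))%E)); last by move=> j _; rewrite muleA muleC.
  rewrite nneseriesZl; last by move=> j _; rewrite mule_ge0 ?lee_fin.
  by rewrite muleC lee_wpmul2l ?lee_fin// riesz_kernel_far_shells.
apply: (@le_trans _ _ (\int[mu]_y (\sum_(j <oo) g j y))%E).
  apply: ge0_subset_integral => //.
  - by apply: measurableC; exact: measurable_row_ball.
  - by apply: ge0_emeasurable_sum.
  - by move=> y _; exact: nneseries_ge0.
rewrite integral_nneseries//.
pose M := k * (4 ^+ n * e + e `^ (1 - s) * r `^ (a * s - n%:R) * X).
have M0 : 0 <= M.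
  by rewrite mulr_ge0 ?(ltW k0)// addr_ge0 ?mulr_ge0 ?exprn_ge0 ?powR_ge0// ltW.
apply: (@le_trans _ _ (\sum_(j <oo) (M * q ^+ j)%:E)%E).
  apply: lee_nneseries => j _; first by move=> _; exact: integral_ge0.
  rewrite ge0_integralZl//; last first.
  - by rewrite lee_fin.
  - by move=> y _; rewrite mule_ge0 ?lee_fin.
  - by apply: emeasurable_funM => //; exact: measurable_indic_row.
  pose h := e * r `^ (- a) * (2 `^ (- (n%:R / s))) ^+ j.
  have h0 : 0 < h by rewrite !mulr_gt0 ?exprn_gt0 ?powR_gt0.
  have := @integral_trunc_le R n (B j) phi s h X%:E (mB j) mphi phi0 h0 s1 phiX.
  rewrite lebesgue_ball ?mulr_gt0 ?exprn_gt0// -EFinM -EFinM -EFinD (integral_mkcond (B j)) => H.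
  rewrite (eq_integral ((fun y => (phi y)%:E) \_ (B j))); last first.
    move=> y _; rewrite patchE indicE; by case: (y \in B j); rewrite /= ?mul1e ?mul0e.
  apply: le_trans (lee_wpmul2l _ H) _; first by rewrite lee_fin.
  rewrite -EFinM lee_fin le_eqVlt; apply/orP; left; apply/eqP.
  have r2 : 0 < r * 2 ^+ j by rewrite mulr_gt0// exprn_gt0.
  rewrite /c /M /h /q -!powRX//.
  have -> : 2 * (r * 2 ^+ j.+1) = 4 * r * 2 ^+ j by rewrite exprS; ring.
  by rewrite -!(mulrA k) far_shell_identity ?gt_eqF// exprn_gt0.
rewrite nneseries_geometric ?(ltW q0)// lee_fin /M.
rewrite -[leRHS]mulrA -[leRHS]mulrA -!(mulrA k) ler_wpM2l ?(ltW k0)//.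
rewrite [leRHS]mulrCA mulrC ler_wpM2l ?invr_ge0 ?(ltW q'0)// [leRHS]mulrDr.
by rewrite lerD2l ler_peMl ?exprn_ege1 ?ler1n// !mulr_ge0 ?powR_ge0.
Qed.

Lemma far_potential_small a s : 0 < a -> a < n%:R -> 1 < s -> a * s < n%:R ->
  exists2 K : R, 0 < K & forall (phi : V -> R) (r : R) x,
  measurable_fun setT phi -> (forall y, 0 <= phi y) -> 0 < r ->
  (\int[mu]_y (phi y `^ s)%:E <= (K * r `^ (n%:R - a * s))%:E)%E ->
  (\int[mu]_(y in ~` ball x r) (riesz_kernel a (x - y) * (phi y)%:E) <=
     2^-1%:E)%E.
Proof.
move=> a0 an s1 asn; have [C C0 HC] := far_potential_le a0 an s1 asn.
(* With the energy bound [e / e^(1-s) * r^(n - a s)] both terms of the far estimate equal [e], and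
   [C (e + e) = 1/2]. *)
pose e := (4 * C)^-1; have e0 : 0 < e by rewrite invr_gt0 mulr_gt0.
exists (e / e `^ (1 - s)); first by rewrite divr_gt0// powR_gt0.
move=> phi r x mphi phi0 r0 phiX.
apply: le_trans (HC _ _ _ _ _ mphi phi0 phiX _ e0 r0) _.
  by rewrite mulr_ge0 ?powR_ge0// divr_ge0 ?powR_ge0// ltW.
rewrite lee_fin -(opprB n%:R) powRN.
have H1 : e `^ (1 - s) != 0 by rewrite gt_eqF// powR_gt0.
have H2 : r `^ (n%:R - a * s) != 0 by rewrite gt_eqF// powR_gt0.
have -> : e `^ (1 - s) * (r `^ (n%:R - a * s))^-1 *
  (e / e `^ (1 - s) * r `^ (n%:R - a * s)) = e by field; rewrite H1 H2.
have -> : C * (e + e) = 2^-1 by rewrite /e; field; rewrite gt_eqF.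
by [].
Qed.

End far_potential.

(** * Riesz capacities *)

Section riesz_capacity.
Context (R : realType) (n : nat).
Local Notation V := 'rV[R]_n.
Local Notation mu := (lebesgue_rV R n).
Implicit Types (x y w : V) (a g r s : R) (phi : V -> R) (E F : set V).

Definition energy s phi : \bar R := (\int[mu]_y (phi y `^ s)%:E)%E.

Definition tests a phi E := [/\ measurable_fun setT phi, forall x, 0 <= phi x &
  forall x, E x -> (1 <= riesz_potential a phi x)%E].

Lemma energy_ge0 s phi : (0 <= energy s phi)%E.
Proof. by apply: integral_ge0 => y _; rewrite lee_fin powR_ge0. Qed.

(** The power [s] cancels the root in the norm, and the sign of [phi] removes the absolute value.
    All estimates below work with this plain integral. *)
Lemma riesz_capE a s E : 0 < s -> riesz_cap a s E =
  ereal_inf [set energy s phi | phi in [set phi | tests a phi E]].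
Proof.
move=> s0; congr ereal_inf; apply/eq_imagel => phi [_ phi0 _].
rewrite (poweR_Lnorm _ _ (lt0r_neq0 s0)); apply: eq_integral => y _.
by rewrite /= ger0_norm.
Qed.

Lemma riesz_cap_le a s E phi : 0 < s -> tests a phi E ->
  (riesz_cap a s E <= energy s phi)%E.
Proof. by move=> s0 tphi; rewrite riesz_capE//; apply: ereal_inf_lbound; exists phi. Qed.

Lemma riesz_cap_lt a s E (X : \bar R) : 0 < s -> (riesz_cap a s E < X)%E ->
  exists2 phi, tests a phi E & (energy s phi < X)%E.
Proof.
move=> s0; rewrite riesz_capE// => /ereal_inf_lt[_ [phi tphi <-] phiX].
by exists phi.
Qed.

Lemma riesz_cap_ge0 a s E : 0 < s -> (0 <= riesz_cap a s E)%E.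
Proof.
move=> s0; rewrite riesz_capE//; apply: le_ereal_inf_tmp => _ [phi _ <-].
exact: energy_ge0.
Qed.

Lemma testsS a phi E F : E `<=` F -> tests a phi F -> tests a phi E.
Proof. by move=> EF [mphi phi0 phiF]; split => // x /EF/phiF. Qed.

Lemma le_riesz_cap a s E F : 0 < s -> E `<=` F ->
  (riesz_cap a s E <= riesz_cap a s F)%E.
Proof.
move=> s0 EF; rewrite [leRHS]riesz_capE//; apply: le_ereal_inf_tmp => _ [phi tphi <-].
by apply: riesz_cap_le => //; exact: testsS tphi.
Qed.

Lemma measurable_energy_density s phi : measurable_fun setT phi ->
  measurable_fun setT (fun y => (phi y `^ s)%:E).
Proof.
by move=> mphi; apply/measurable_EFinP/(measurableT_comp (measurable_powR _)).
Qed.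

Lemma energyZ s (e : R) phi : measurable_fun setT phi -> (forall y, 0 <= phi y) ->
  0 <= e -> energy s (fun y => e * phi y) = ((e `^ s)%:E * energy s phi)%E.
Proof.
move=> mphi phi0 e0; rewrite /energy -ge0_integralZl//; last 3 first.
- exact: measurable_energy_density.
- by move=> y _; rewrite lee_fin powR_ge0.
- by rewrite lee_fin powR_ge0.
by apply: eq_integral => y _; rewrite powRM.
Qed.

Lemma riesz_potentialZ a (e : R) phi x : 0 < a -> a < n%:R ->
  measurable_fun setT phi -> (forall y, 0 <= phi y) -> 0 <= e ->
  riesz_potential a (fun y => e * phi y) x = (e%:E * riesz_potential a phi x)%E.
Proof.
move=> a0 an mphi phi0 e0; rewrite /riesz_potential -ge0_integralZl//; last 2 first.
- exact: measurable_potential.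
- by move=> y _; rewrite mule_ge0 ?lee_fin ?riesz_kernel_ge0.
by apply: eq_integral => y _; rewrite EFinM muleCA.
Qed.

(* The test function for the union is the l^s-norm of the test functions of the
   pieces; it may be infinite on a null set, where it is replaced by 0. *)
Lemma riesz_cap_sigma_subadditive a s (E : (set V)^nat) (F : set V) :
  0 < a -> a < n%:R -> 0 < s -> F `<=` \bigcup_k E k ->
  (riesz_cap a s F <= \sum_(k <oo) riesz_cap a s (E k))%E.
Proof.
move=> a0 an s0 FE.
have capE0 k : (0 <= riesz_cap a s (E k))%E by exact: riesz_cap_ge0.
have [->|Efin] := eqVneq (\sum_(k <oo) riesz_cap a s (E k))%E +oo%E.
  exact: leey.
apply/lee_addgt0Pr => e e0.
have H k : exists phi, tests a phi (E k) /\
    (energy s phi <= riesz_cap a s (E k) + (e / (2 ^ k.+1)%:R)%:E)%E.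
  have [phi tphi phiE] : exists2 phi, tests a phi (E k) &
      (energy s phi < riesz_cap a s (E k) + (e / (2 ^ k.+1)%:R)%:E)%E.
    apply: riesz_cap_lt => //; rewrite lteDl ?lte_fin ?divr_gt0 ?ltr0n ?expn_gt0//.
    rewrite ge0_fin_numE// ltey; apply: contra_neq Efin => Ek.
    by apply/eqP; rewrite -leye_eq -Ek; exact: nneseries_ge_term.
  by exists phi; split => //; exact: ltW.
have {H} [phi phiE] := choice H.
have tphi k := (phiE k).1; have {}phiE k := (phiE k).2.
pose S y := (\sum_(k <oo) (phi k y `^ s)%:E)%E.
have mdens k : measurable_fun setT (fun y => (phi k y `^ s)%:E).
  by apply: measurable_energy_density; case: (tphi k).
have mS : measurable_fun setT S.
  by apply: ge0_emeasurable_sum => // k y _ _; rewrite lee_fin powR_ge0.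
have S0 y : (0 <= S y)%E by apply: nneseries_ge0 => k _; rewrite lee_fin powR_ge0.
have intS : (\int[mu]_y S y <= \sum_(k <oo) riesz_cap a s (E k) + e%:E)%E.
  rewrite integral_nneseries//; last by move=> k y _; rewrite lee_fin powR_ge0.
  apply: le_trans (epsilon_trick _ _ (ltW e0)) => //.
  by apply: lee_nneseries => // k _; [move=> _; exact: energy_ge0|exact: phiE].
pose psi y := fine (S y) `^ s^-1.
have mpsi : measurable_fun setT psi.
  apply: (measurableT_comp (measurable_powR _)).
  exact: measurableT_comp.
have psis y : psi y `^ s = fine (S y).
  by rewrite /psi -powRrM mulVf ?gt_eqF// powRr1// fine_ge0.
have fineS y : ((fine (S y))%:E <= S y)%E.
  by have := S0 y; case: (S y) => [r|_|]//=; rewrite ?lexx ?leey.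
apply: (@le_trans _ _ (energy s psi)); last first.
  apply: le_trans intS; apply: ge0_le_integral => //.
  - by move=> y _; rewrite lee_fin powR_ge0.
  - exact: measurable_energy_density.
  - by move=> y _; rewrite psis.
have finS : {ae mu, forall y, setT y -> S y \is a fin_num}.
  apply: integrable_ae => //; apply/integrableP; split => //.
  under eq_integral do rewrite gee0_abs//.
  by rewrite (le_lt_trans intS)// lte_add_pinfty ?ltry// ltey.
apply: riesz_cap_le => //; split => // [y|x /FE[k _ Ekx]]; first exact: powR_ge0.
have [mphi phi0 /(_ _ Ekx)] := tphi k; move/le_trans; apply.
(* [psi] dominates [phi k] only where [S] is finite, hence almost everywhere. *)
apply: ae_ge0_le_integral => //.
- by move=> y _; rewrite mule_ge0 ?lee_fin ?riesz_kernel_ge0.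
- exact: measurable_potential.
- by move=> y _; rewrite mule_ge0 ?lee_fin ?riesz_kernel_ge0 ?powR_ge0.
- exact: measurable_potential.
apply: filterS finS => y /(_ I) Sfin _.
rewrite lee_wpmul2l ?riesz_kernel_ge0// lee_fin.
rewrite -[leLHS](powRr1 (phi0 y)) -(divff (lt0r_neq0 s0)) powRrM.
rewrite ge0_ler_powR ?invr_ge0 ?nnegrE ?(ltW s0) ?powR_ge0 ?fine_ge0//.
rewrite -lee_fin fineK//.
by apply: (nneseries_ge_term (u := fun k => (phi k y `^ s)%:E)) => j; rewrite lee_fin powR_ge0.
Qed.

(** A multiple [e] of the indicator of [ball x (2 r)] is a test function: every [z] in [ball x r]
    sees the value [e] on all of [ball z r]. *)
Lemma riesz_cap_ball_le a s : 0 < a -> a < n%:R -> 0 < s ->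
  exists2 C : R, 0 < C & forall x r, 0 < r ->
  (riesz_cap a s (ball x r) <= (C * r `^ (n%:R - a * s))%:E)%E.
Proof.
move=> a0 an s0.
have n0 : 0 < n%:R :> R by exact: lt_trans an.
have k0 : 0 < (riesz_const n a)^-1 by rewrite invr_gt0 riesz_const_gt0.
have d0 : 0 < Num.sqrt n%:R :> R by rewrite sqrtr_gt0.
(* [A r^a] bounds from below the potential, at its centre, of the indicator of a ball of radius [r];
   [e] is the reciprocal. *)
pose A := (riesz_const n a)^-1 * Num.sqrt n%:R `^ (a - n%:R) * 2 ^+ n.
have A0 : 0 < A by rewrite !mulr_gt0 ?exprn_gt0 ?powR_gt0.
exists (A^-1 `^ s * 4 ^+ n); first by rewrite mulr_gt0 ?powR_gt0 ?invr_gt0 ?exprn_gt0.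
move=> x r r0.
have mB : measurable (ball x (2 * r) : set V) by exact: measurable_row_ball.
pose e := A^-1 * r `^ (- a).
have e0 : 0 < e by rewrite mulr_gt0 ?invr_gt0 ?powR_gt0.
pose phi y := e * \1_(ball x (2 * r) : set V) y.
have phi0 y : 0 <= phi y by rewrite mulr_ge0// ltW.
have mphi : measurable_fun setT phi.
  by apply: measurable_funM => //; exact/measurable_indicP.
apply: le_trans (@riesz_cap_le a s _ phi s0 _) _.
  split => // z xz.
  apply: (@le_trans _ _ (\int[mu]_(y in ball z r) (cst
    ((riesz_const n a)^-1 * (Num.sqrt n%:R * r) `^ (a - n%:R) * e)%:E y))%E).
    rewrite integral_cst ?lebesgue_ball//; last exact: measurable_row_ball.
    rewrite -EFinM lee_fin le_eqVlt; apply/orP; left; apply/eqP.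
    rewrite powRM ?(ltW d0) ?(ltW r0)// exprMn -(powR_mulrn n (ltW r0)) /e.
    have rr : r `^ (a - n%:R) * r `^ (- a) * r `^ n%:R = 1.
      rewrite -!powRD ?(gt_eqF r0) ?implybT//.
      have -> : a - n%:R - a + n%:R = 0 by ring.
      exact: powRr0.
    rewrite -[LHS]mulr1 -{1}rr -[LHS]mul1r -{1}(divff (lt0r_neq0 A0)) {1}/A.
    by ring.
  apply: (@le_trans _ _ (\int[mu]_(y in ball z r)
     (riesz_kernel a (z - y) * (phi y)%:E))%E).
    apply: ge0_le_integral => //.
    - exact: measurable_row_ball.
    - by move=> y _; rewrite lee_fin (mulr_ge0 (mulr_ge0 (ltW k0) (powR_ge0 _ _)) (ltW e0)).
    - exact: measurable_funTS (measurable_potential _ _ mphi).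
    move=> y zy; have -> : phi y = e.
      rewrite /phi indicE mem_set ?mulr1//.
      have -> : 2 * r = r + r by ring.
      exact: ball_triangle xz zy.
    rewrite [leLHS]EFinM lee_wpmul2r ?lee_fin ?(ltW e0)//.
    by rewrite riesz_kernel_ge//; move: zy; rewrite ballN => /ltW.
  apply: ge0_subset_integral => //; first exact: measurable_row_ball.
    exact: measurable_potential.
  by move=> y _; rewrite mule_ge0 ?lee_fin ?riesz_kernel_ge0.
rewrite energyZ ?(ltW e0)//.
rewrite /energy (eq_integral (fun y => (\1_(ball x (2 * r) : set V) y)%:E)); last first.
  by move=> y _; rewrite indicE; case: (_ \in _); rewrite /= ?powR1 ?powR0 ?gt_eqF.
rewrite integral_indic// setIT lebesgue_ball ?mulr_gt0// -EFinM lee_fin.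
rewrite /e powRM ?invr_ge0 ?powR_ge0 ?(ltW A0)// -powRrM mulrA -natrM exprMn.
rewrite -(powR_mulrn n (ltW r0)) mulrACA -powRD ?(gt_eqF r0) ?implybT//.
by rewrite addrC mulNr.
Qed.

End riesz_capacity.

(** * Isocapacitary inequalities at a given radius *)

Section isocapacitary.
Context (R : realType) (n : nat).
Local Notation V := 'rV[R]_n.
Local Notation mu := (lebesgue_rV R n).
Implicit Types (x y w : V) (a g r s : R) (phi : V -> R) (E F : set V).

Lemma riesz_potential_split a phi x (B : set V) : measurable B ->
  0 < a -> a < n%:R -> measurable_fun setT phi -> (forall y, 0 <= phi y) ->
  riesz_potential a phi x =
    (\int[mu]_(y in B) (riesz_kernel a (x - y) * (phi y)%:E) +
     \int[mu]_(y in ~` B) (riesz_kernel a (x - y) * (phi y)%:E))%E.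
Proof.
move=> mB a0 an mphi phi0; rewrite -ge0_integral_setU//.
- by rewrite setUv.
- exact: measurableC.
- exact: measurable_funTS (measurable_potential _ _ mphi).
- by move=> y _; rewrite mule_ge0 ?lee_fin ?riesz_kernel_ge0.
- by apply/disj_setPS => y [].
Qed.

(** The far part of the potential is at most 1/2, so a potential of at least 1 leaves 1/2 for the
    near part. *)
Lemma near_potential_ge a s : 0 < a -> a < n%:R -> 1 < s -> a * s < n%:R ->
  exists2 K : R, 0 < K & forall phi E r, 0 < r -> tests a phi E ->
  (energy s phi <= (K * r `^ (n%:R - a * s))%:E)%E -> forall x, E x ->
  (2^-1%:E <= \int[mu]_(y in ball x r) (riesz_kernel a (x - y) * (phi y)%:E))%E.
Proof.
move=> a0 an s1 asn; have [K K0 HK] := far_potential_small a0 an s1 asn.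
exists K => // phi E r r0 [mphi phi0 phiE] phiK x Ex.
have := phiE x Ex.
rewrite (riesz_potential_split x (measurable_row_ball x r))// => near_far.
have := HK phi r x mphi phi0 r0 phiK => far.
have := le_trans near_far (leeD2l _ far).
rewrite -leeBlDr// -EFinB.
by have -> : 1 - 2^-1 = 2^-1 :> R by field.
Qed.

(* The truncation of the potential of order [a] to a ball of radius [r] is at
   most a multiple of [r `^ (a - g)] times the potential of order [g]. *)
Lemma isocapacitary_riesz g a s : 0 < g -> g <= a -> a < n%:R -> 1 < s ->
  a * s < n%:R ->
  exists K A : R, [/\ 0 < K, 0 < A & forall phi E r, 0 < r -> tests a phi E ->
  (energy s phi <= (K * r `^ (n%:R - a * s))%:E)%E ->
  (riesz_cap g s E <= (A * r `^ (n%:R - g * s))%:E)%E].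
Proof.
move=> g0 ga an s1 asn.
have a0 : 0 < a by exact: lt_le_trans ga.
have gn : g < n%:R by exact: le_lt_trans an.
have s0 : 0 < s by exact: lt_trans s1.
have n0 : 0 < n%:R :> R by exact: lt_trans an.
have d0 : 0 < Num.sqrt n%:R :> R by rewrite sqrtr_gt0.
have kg := riesz_const_gt0 g0 gn; have ka := riesz_const_gt0 a0 an.
have [K K0 HK] := near_potential_ge a0 an s1 asn.
(* The 2 makes up for the lower bound 1/2 of the near part; the rest is the constant of
   [riesz_kernel_order]. *)
pose B := 2 * (riesz_const n g / riesz_const n a) * Num.sqrt n%:R `^ (a - g).
have B0 : 0 < B.
  apply: mulr_gt0; last exact: powR_gt0.
  exact: mulr_gt0 (ltr0Sn _ 1) (divr_gt0 kg ka).
exists K, (B `^ s * K); split => //; first by rewrite mulr_gt0 ?powR_gt0.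
move=> phi E r r0 tphi phiK; have [mphi phi0 phiE] := tphi.
pose b := B * r `^ (a - g).
have b0 : 0 < b by rewrite mulr_gt0 ?powR_gt0.
apply: le_trans (@riesz_cap_le _ _ g s E (fun y => b * phi y) s0 _) _; last first.
  rewrite energyZ ?(ltW b0)//.
  apply: le_trans (lee_wpmul2l _ phiK) _; first by rewrite lee_fin powR_ge0.
  rewrite -EFinM lee_fin /b powRM ?powR_ge0 ?(ltW B0)// -powRrM mulrACA.
  rewrite -powRD ?(gt_eqF r0) ?implybT//.
  by have -> : (a - g) * s + (n%:R - a * s) = n%:R - g * s by ring.
split => [|y|x Ex]; first exact: measurable_funM.
  by rewrite mulr_ge0// ltW.
have near := HK phi E r r0 tphi phiK x Ex.
have mphib : measurable_fun setT (fun y => b * phi y) by exact: measurable_funM.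
have phib0 y : 0 <= b * phi y by rewrite mulr_ge0// ltW.
rewrite (riesz_potential_split x (measurable_row_ball x r))//.
apply: (@le_trans _ _ (2%:E * \int[mu]_(y in ball x r) (riesz_kernel a (x - y) * (phi y)%:E))%E).
  apply: le_trans (lee_wpmul2l _ near); last by rewrite lee_fin.
  by rewrite -EFinM divff.
rewrite -[leLHS]adde0 leeD//; last first.
  by apply: integral_ge0 => y _; rewrite mule_ge0 ?lee_fin ?riesz_kernel_ge0.
have mB : measurable (ball x r : set V) by exact: measurable_row_ball.
rewrite -ge0_integralZl//; last 2 first.
- exact: measurable_funTS (measurable_potential _ _ mphi).
- by move=> y _; rewrite mule_ge0 ?lee_fin ?riesz_kernel_ge0.
apply: ge0_le_integral => //.
- by move=> y _; apply: mule_ge0 => //; rewrite mule_ge0 ?lee_fin ?riesz_kernel_ge0.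
- exact: measurable_funeM (measurable_funTS (measurable_potential _ _ mphi)).
- exact: measurable_funTS (measurable_potential _ _ mphib).
move=> y; rewrite ballN => /ltW xyr.
rewrite EFinM (muleA 2%:E) (muleA (riesz_kernel g _)) lee_wpmul2r ?lee_fin//.
apply: le_trans (lee_wpmul2l _ (riesz_kernel_order g0 ga an r0 xyr)) _.
  by rewrite lee_fin.
rewrite muleA [leRHS]muleC -EFinM lee_wpmul2r ?riesz_kernel_ge0//.
by rewrite lee_fin /b /B powRM ?(ltW d0) ?(ltW r0)// !mulrA.
Qed.

Lemma integral_indic_mull (B : set V) (f : V -> \bar R) :
  (\int[mu]_y ((\1_B y)%:E * f y) = \int[mu]_(y in B) f y)%E.
Proof.
rewrite [RHS]integral_mkcond; apply: eq_integral => y _.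
by rewrite patchE indicE; case: (y \in B); rewrite /= ?mul1e ?mul0e.
Qed.

Lemma measurable_row_sub i :
  measurable_fun setT (fun z : V * V => (z.1 - z.2) 0 i : R).
Proof.
rewrite (_ : (fun _ => _) = fun z : V * V => z.1 0 i - z.2 0 i); last first.
  by apply/funext => z; rewrite !mxE.
apply: measurable_funB.
  exact: (measurableT_comp (measurable_row_coord i) measurable_fst).
exact: (measurableT_comp (measurable_row_coord i) measurable_snd).
Qed.

Lemma measurable_dist_lt r : measurable [set z : V * V | ball z.1 r z.2].
Proof.
have [r0|r0] := ltP 0 r; last first.
  rewrite (_ : mkset _ = set0)//; apply/seteqP; split => // z /=.
  by rewrite ballN => /(le_lt_trans (normr_ge0 _)); rewrite ltNge r0.
rewrite (_ : mkset _ = \bigcap_(i in [set: 'I_n])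
     ((fun z : V * V => (z.1 - z.2) 0 i) @^-1` ball 0 r)); last first.
  apply/seteqP; split => [z [_ H] i _|z H] /=.
    by rewrite -ball_normE/= sub0r normrN !mxE; exact: H.
  rewrite ball_rowE// => i; have := H i I.
  by rewrite -!ball_normE/= sub0r normrN !mxE.
apply: fin_bigcap_measurable; first exact: finite_finset.
move=> i _; rewrite -[X in measurable X]setTI.
by apply: measurable_row_sub => //; exact: measurable_ball.
Qed.

(** Chebyshev's inequality replaces the comparison of kernels: on [E] the localized potential [N] of
    [phi^s] is bounded below, and Tonelli bounds its integral by [C r^a] times the energy. *)
Lemma isocapacitary_lebesgue a s : 0 < a -> a < n%:R -> 1 < s -> a * s < n%:R ->
  exists K A : R, [/\ 0 < K, 0 < A & forall phi E r, 0 < r -> tests a phi E ->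
  (energy s phi <= (K * r `^ (n%:R - a * s))%:E)%E ->
  (mu^*%mu E <= (A * r `^ n%:R)%:E)%E].
Proof.
move=> a0 an s1 asn.
have s0 : 0 < s by exact: lt_trans s1.
have [K K0 HK] := near_potential_ge a0 an s1 asn.
have [C C0 HC] := @integral_riesz_kernel_ball R n a a0 an.
(* At the level [h = e r^(-a)] the truncated part contributes at most [e C = 1/4], half of the lower
   bound 1/2 for the near potential. *)
pose e := (4 * C)^-1; have e0 : 0 < e by rewrite invr_gt0 mulr_gt0.
exists K, (4 * (e `^ (1 - s) * (C * K))); split => //.
  by rewrite !mulr_gt0// powR_gt0.
move=> phi E r r0 tphi phiK; have [mphi phi0 phiE] := tphi.
pose h := e * r `^ (- a); have h0 : 0 < h by rewrite mulr_gt0 ?powR_gt0.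
pose f (z : V * V) : \bar R := ((\1_[set z : V * V | ball z.1 r z.2] z : R)%:E *
  (riesz_kernel a (z.1 - z.2) * (phi z.2 `^ s)%:E))%E.
have f0 z : (0 <= f z)%E.
  apply: mule_ge0; first by rewrite lee_fin.
  by rewrite mule_ge0 ?lee_fin ?riesz_kernel_ge0 ?powR_ge0.
have mf : measurable_fun setT f.
  apply: emeasurable_funM; first by apply/measurable_EFinP/measurable_indicP; exact: measurable_dist_lt.
  apply: emeasurable_funM.
    apply: measurable_riesz_kernel => i.
    exact: measurable_row_sub.
  exact: (measurableT_comp (measurable_energy_density s mphi) measurable_snd).
pose N x := (\int[mu]_y f (x, y))%E.
have mN : measurable_fun setT N by exact: measurable_tonelli_row1.
have N0 x : (0 <= N x)%E by exact: integral_ge0.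
have intN : (\int[mu]_x N x <= (C * r `^ a)%:E * energy s phi)%E.
  rewrite /N tonelli_row// -ge0_integralZl//; last 3 first.
  - exact: measurable_energy_density.
  - by move=> y _; rewrite lee_fin powR_ge0.
  - by rewrite lee_fin mulr_ge0 ?powR_ge0// ltW.
  apply: (@ge0_le_integral _ V R mu setT measurableT).
  - by move=> y _; exact: integral_ge0.
  - exact: measurable_tonelli_row2.
  - by apply: measurable_funeM; exact: measurable_energy_density.
  move=> y _.
  have -> : (\int[mu]_x f (x, y) = \int[mu]_x ((phi y `^ s)%:E *
      ((\1_(ball y r) x)%:E * riesz_kernel a (y - x))))%E.
    apply: eq_integral => x _; rewrite /f /= -opprB riesz_kernelN.
    rewrite [RHS]muleCA [X in (_ * X)%E]muleC; congr ((_%:E * _)%E).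
    rewrite !indicE; congr ((_ : bool)%:R); apply/idP/idP; rewrite !inE => /ball_sym; exact.
  rewrite ge0_integralZl//; last 3 first.
  - apply: emeasurable_funM; last exact: measurable_kernel_sub.
    by apply: measurable_indic_row; exact: measurable_row_ball.
  - by move=> x _; rewrite mule_ge0 ?lee_fin ?riesz_kernel_ge0.
  - by rewrite lee_fin powR_ge0.
  rewrite integral_indic_mull muleC lee_wpmul2r ?lee_fin ?powR_ge0//.
  exact: HC.
(* What remains, [1/2 - 1/4], is a lower bound for [h^(1-s) N x]. *)
pose b := (4 * h `^ (1 - s))^-1.
have b0 : 0 < b by rewrite invr_gt0 mulr_gt0 ?powR_gt0.
have EN : E `<=` [set x | (b%:E <= N x)%E].
  move=> x Ex; have near := HK phi E r r0 tphi phiK x Ex.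
  have mB : measurable (ball x r : set V) by exact: measurable_row_ball.
  have mk : measurable_fun setT (fun y => riesz_kernel a (x - y)) by exact: measurable_kernel_sub.
  have mks : measurable_fun setT (fun y => riesz_kernel a (x - y) * (phi y `^ s)%:E)%E.
    by apply: emeasurable_funM => //; exact: measurable_energy_density.
  have Nx : N x = (\int[mu]_(y in ball x r) (riesz_kernel a (x - y) * (phi y `^ s)%:E))%E.
    by rewrite -integral_indic_mull.
  have {near} : (2^-1%:E <= \int[mu]_(y in ball x r)
      (h%:E * riesz_kernel a (x - y) +
       (h `^ (1 - s))%:E * (riesz_kernel a (x - y) * (phi y `^ s)%:E)))%E.
    apply: le_trans near _; apply: ge0_le_integral => //.
    - by move=> y _; rewrite mule_ge0 ?lee_fin ?riesz_kernel_ge0.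
    - exact: measurable_funTS (measurable_potential _ _ mphi).
    - apply: measurable_funTS; apply: emeasurable_funD; exact: measurable_funeM.
    move=> y _; rewrite (muleC h%:E) (muleCA (h `^ (1 - s))%:E) -ge0_muleDr ?lee_fin ?(ltW h0)//.
      by rewrite lee_wpmul2l ?riesz_kernel_ge0// lee_fin ler_truncation.
    by rewrite mulr_ge0 ?powR_ge0.
  rewrite ge0_integralD//; last 4 first.
  - by move=> y _; rewrite mule_ge0 ?lee_fin ?riesz_kernel_ge0// ltW.
  - exact: measurable_funeM (measurable_funTS mk).
  - move=> y _; apply: mule_ge0; first by rewrite lee_fin powR_ge0.
    by rewrite mule_ge0 ?lee_fin ?riesz_kernel_ge0 ?powR_ge0.
  - exact: measurable_funeM (measurable_funTS mks).
  have hE : (0 <= h%:E)%E by rewrite lee_fin ltW.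
  have hsE : (0 <= (h `^ (1 - s))%:E)%E by rewrite lee_fin powR_ge0.
  have k0 y : ball x r y -> (0 <= riesz_kernel a (x - y))%E by rewrite riesz_kernel_ge0.
  have ks0 y : ball x r y -> (0 <= riesz_kernel a (x - y) * (phi y `^ s)%:E)%E.
    by rewrite mule_ge0 ?lee_fin ?riesz_kernel_ge0 ?powR_ge0.
  rewrite (ge0_integralZl mu mB (measurable_funTS mk) k0 hE).
  rewrite (ge0_integralZl mu mB (measurable_funTS mks) ks0 hsE).
  rewrite -Nx => /le_trans/(_ (leeD2r _ (lee_wpmul2l _ (HC x r r0)))).
  rewrite lee_fin => /(_ (ltW h0)).
  have -> : (h%:E * (C * r `^ a)%:E)%E = 4^-1%:E.
    rewrite -EFinM /h; congr EFin.
    have -> : e * r `^ (- a) * (C * r `^ a) = e * C * (r `^ a * r `^ (- a)) by ring.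
    rewrite powRN divff ?gt_eqF ?powR_gt0// /e; field; rewrite gt_eqF//.
  rewrite addeC -leeBlDr// -EFinB /= /b.
  have -> : 2^-1 - 4^-1 = 4^-1 :> R by field.
  have hs : 0 < h `^ (1 - s) by rewrite powR_gt0.
  by rewrite -lee_pdivrMl// -EFinM invfM mulrC.
have mG : measurable [set x | (b%:E <= N x)%E].
  by rewrite -[X in measurable X]setTI; exact: emeasurable_fun_c_infty.
(* [E] may fail to be measurable; the superlevel set of [N] is a measurable superset. *)
apply: (@le_trans _ _ (mu [set x | (b%:E <= N x)%E])).
  by rewrite -measurable_mu_extE//; exact: le_mu_ext.
have : (b%:E * mu [set x | (b%:E <= N x)%E] <= \int[mu]_x N x)%E.
  rewrite -integral_cst//.
  apply: (@le_trans _ _ (\int[mu]_(x in [set x | (b%:E <= N x)%E]) N x)%E).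
    apply: ge0_le_integral => //; first by move=> x _; rewrite lee_fin ltW.
    exact: measurable_funTS.
  exact: ge0_subset_integral.
move=> /le_trans/(_ intN)/le_trans/(_ (lee_wpmul2l _ phiK)).
rewrite lee_fin => /(_ (mulr_ge0 (ltW C0) (powR_ge0 _ _))).
rewrite -lee_pdivlMl// => /le_trans; apply.
rewrite -!EFinM lee_fin le_eqVlt; apply/orP; left; apply/eqP.
rewrite /b invrK /h powRM ?(ltW e0) ?powR_ge0// -powRrM.
transitivity (4 * (e `^ (1 - s) * (C * K)) *
  (r `^ (- a * (1 - s)) * r `^ a * r `^ (n%:R - a * s))); first by ring.
congr (_ * _); rewrite -!powRD ?(gt_eqF r0) ?implybT//; congr (_ `^ _); ring.
Qed.

End isocapacitary.

(** * Capacities of zero and of positive order together *)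

Section capacities.
Context (R : realType) (n : nat) (c : R).
Hypothesis c0 : 0 < c.
Local Notation V := 'rV[R]_n.
Local Notation mu := (lebesgue_rV R n).
Implicit Types (x y w : V) (a g r s : R) (phi : V -> R) (E F : set V).

Lemma cap0E s E : cap c 0 s E = (c%:E * mu^*%mu E)%E.
Proof. by rewrite /cap eqxx. Qed.

Lemma cap_neq0E a s E : a != 0 -> cap c a s E = riesz_cap a s E.
Proof. by move=> a0; rewrite /cap (negbTE a0). Qed.

Lemma cap_ge0 a s E : 0 < s -> (0 <= cap c a s E)%E.
Proof.
move=> s0; have [->|a0] := eqVneq a 0; last by rewrite cap_neq0E// riesz_cap_ge0.
by rewrite cap0E mule_ge0 ?lee_fin ?(ltW c0)// mu_ext_ge0.
Qed.

Lemma le_cap a s E F : 0 < s -> E `<=` F -> (cap c a s E <= cap c a s F)%E.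
Proof.
move=> s0 EF; have [->|a0] := eqVneq a 0; last by rewrite !cap_neq0E// le_riesz_cap.
by rewrite !cap0E lee_wpmul2l ?lee_fin ?(ltW c0)//; exact: le_mu_ext.
Qed.

Lemma cap_ball_le g s : 0 <= g -> g < n%:R -> 0 < s ->
  exists2 C : R, 0 < C & forall x r, 0 < r ->
  (cap c g s (ball x r) <= (C * r `^ (n%:R - g * s))%:E)%E.
Proof.
rewrite le_eqVlt => /predU1P[<- n0 s0|g0 gn s0]; last first.
  have [C C0 HC] := riesz_cap_ball_le g0 gn s0.
  by exists C => // x r r0; rewrite cap_neq0E ?gt_eqF// HC.
exists (c * 2 ^+ n); first by rewrite mulr_gt0// exprn_gt0.
move=> x r r0; rewrite cap0E measurable_mu_extE; last exact: measurable_row_ball.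
by rewrite lebesgue_ball// -EFinM mul0r subr0 (powR_mulrn _ (ltW r0)) exprMn mulrA.
Qed.

Lemma isocapacitary_small g a s : 0 <= g -> g < a -> a < n%:R -> 1 < s ->
  a * s < n%:R ->
  exists K A : R, [/\ 0 < K, 0 < A & forall phi E r, 0 < r -> tests a phi E ->
  (energy s phi <= (K * r `^ (n%:R - a * s))%:E)%E ->
  (cap c g s E <= (A * r `^ (n%:R - g * s))%:E)%E].
Proof.
rewrite le_eqVlt => /predU1P[<- a0 an s1 asn|g0 ga an s1 asn].
  have [K [A [K0 A0 HA]]] := isocapacitary_lebesgue a0 an s1 asn.
  exists K, (c * A); split => //; first exact: mulr_gt0.
  move=> phi E r r0 tphi phiK; rewrite cap0E mul0r subr0 -mulrA EFinM.
  by rewrite lee_wpmul2l ?lee_fin ?(ltW c0)//; exact: HA phiK.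
have [K [A [K0 A0 HA]]] := isocapacitary_riesz g0 (ltW ga) an s1 asn.
exists K, A; split => // phi E r r0 tphi phiK.
by rewrite cap_neq0E ?gt_eqF//; exact: HA phiK.
Qed.

(** The radius is a free parameter of [isocapacitary_small]; choosing it so that the energy equals
    [K r^(n - a s)] gives the scale-invariant form. *)
Lemma isocapacitary g a s : 0 <= g -> g < a -> a < n%:R -> 1 < s ->
  a * s < n%:R ->
  exists2 A : R, 0 < A & forall phi E, tests a phi E ->
  (cap c g s E <=
    A%:E * energy s phi `^ ((n%:R - g * s) / (n%:R - a * s)))%E.
Proof.
move=> g0 ga an s1 asn; have s0 : 0 < s by exact: lt_trans s1.
have [K [A [K0 A0 HA]]] := isocapacitary_small g0 ga an s1 asn.
have das : 0 < n%:R - a * s by rewrite subr_gt0.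
have dgs : 0 < n%:R - g * s.
  by rewrite subr_gt0 (lt_trans _ asn)// ltr_pM2r.
set q := _ / _; have q0 : 0 < q by rewrite divr_gt0.
exists (A * K^-1 `^ q); first by rewrite mulr_gt0 ?powR_gt0 ?invr_gt0.
move=> phi E tphi.
have : (0 <= energy s phi)%E by exact: energy_ge0.
case eY : (energy s phi) => [Y| |]// Y0; last first.
  by rewrite poweRyr ?gt_eqF// gt0_muley ?leey// lte_fin mulr_gt0 ?powR_gt0 ?invr_gt0.
have {}Y0 : 0 <= Y by rewrite -lee_fin.
rewrite poweR_EFin -EFinM -mulrA.
have [YE|YN] := eqVneq Y 0.
  rewrite YE powR0 ?gt_eqF// !mulr0; apply/lee_addgt0Pr => e e0; rewrite add0e.
  (* Zero energy admits every radius, so the bound can be made equal to any [e > 0]. *)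
  pose r := (e / A) `^ (n%:R - g * s)^-1.
  have r0 : 0 < r by rewrite powR_gt0 ?divr_gt0.
  have := HA phi E r r0 tphi; rewrite eY YE lee_fin mulr_ge0 ?powR_ge0 ?(ltW K0)//.
  move=> /(_ isT)/le_trans; apply; rewrite lee_fin /r -powRrM mulVf ?gt_eqF//.
  by rewrite powRr1 ?divr_ge0 ?(ltW e0) ?(ltW A0)// mulrC divfK ?gt_eqF.
have {YN}Y1 : 0 < Y by rewrite lt_neqAle eq_sym YN.
pose r := (Y / K) `^ (n%:R - a * s)^-1.
have YK : 0 < Y / K by rewrite divr_gt0.
have r0 : 0 < r by rewrite powR_gt0.
have := HA phi E r r0 tphi; rewrite eY lee_fin {1}/r -powRrM mulVf ?gt_eqF//.
rewrite powRr1 ?(ltW YK)// mulrC divfK ?gt_eqF// lexx => /(_ isT)/le_trans; apply.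
rewrite lee_fin /r -powRrM -powRM ?invr_ge0 ?(ltW K0)//.
by rewrite (mulrC K^-1) (mulrC _ (n%:R - g * s)).
Qed.

(** For positive order, zero capacity would provide test functions of arbitrarily small energy, and
    [isocapacitary_lebesgue] would make the volume of the ball too small. *)
Lemma cap_ball_gt0 g s x r : 0 <= g -> g < n%:R -> 1 < s -> g * s < n%:R ->
  0 < r -> (0 < cap c g s (ball x r))%E.
Proof.
move=> g0 gn s1 gsn r0; have s0 : 0 < s by exact: lt_trans s1.
have mB : measurable (ball x r : set V) by exact: measurable_row_ball.
have [->|gN] := eqVneq g 0.
  rewrite cap0E measurable_mu_extE// lebesgue_ball// -EFinM lte_fin.
  by rewrite mulr_gt0// exprn_gt0// mulr_gt0.
have {gN}g1 : 0 < g by rewrite lt_neqAle eq_sym gN.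
have n0 : 0 < n%:R :> R by exact: lt_trans gn.
have [K [A [K0 A0 HA]]] := isocapacitary_lebesgue g1 gn s1 gsn.
rewrite cap_neq0E ?gt_eqF// ltNge; apply/negP => cap0.
(* Chosen with [A rho^n = r^n], which is less than the volume [(2 r)^n]. *)
pose rho := (r ^+ n / A) `^ n%:R^-1.
have rA : 0 < r ^+ n / A by rewrite divr_gt0 ?exprn_gt0.
have rho0 : 0 < rho by rewrite powR_gt0.
have [phi tphi phiK] : exists2 phi, tests g phi (ball x r) &
    (energy s phi < (K * rho `^ (n%:R - g * s))%:E)%E.
  apply: riesz_cap_lt => //; apply: le_lt_trans cap0 _.
  by rewrite lte_fin mulr_gt0// powR_gt0.
have := HA phi _ rho rho0 tphi (ltW phiK).
rewrite measurable_mu_extE// lebesgue_ball// lee_fin /rho -powRrM mulVf ?gt_eqF//.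
rewrite powRr1 ?(ltW rA)// (mulrC A) divfK ?gt_eqF// exprMn.
rewrite leNgt ltr_pMl ?exprn_gt0// exprn_egt1 ?ltr1n//.
by rewrite -(pnatr_eq0 R) gt_eqF.
Qed.

Lemma eball_ball x r : eball x r `<=` ball x r.
Proof.
by move=> y /(le_lt_trans (norm_le_enorm _)); rewrite ballN distrC.
Qed.

Lemma ball_eball x r : 0 < n%:R :> R -> ball x (r / Num.sqrt n%:R) `<=` eball x r.
Proof.
move=> n0 y; rewrite ballN distrC /eball/= => yx.
rewrite (le_lt_trans (enorm_le_norm _))// mulrC -ltr_pdivlMr// sqrtr_gt0//.
Qed.

(** The normalizing constant in [cap_maximal] is a positive real number, so the division in [\bar R]
    there can be cleared. *)
Lemma cap_unit_eball g s : 0 <= g -> g < n%:R -> 1 < s -> g * s < n%:R ->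
  exists2 k : R, 0 < k & cap c g s (eball (0 : V) 1) = k%:E.
Proof.
move=> g0 gn s1 gsn; have s0 : 0 < s by exact: lt_trans s1.
have n0 : 0 < n%:R :> R by exact: le_lt_trans gn.
have [C C0 HC] := cap_ball_le g0 gn s0.
have h1 : (0 < cap c g s (eball (0 : V) 1))%E.
  apply: lt_le_trans (le_cap _ s0 (@ball_eball 0 1 n0)).
  by apply: cap_ball_gt0 => //; rewrite divr_gt0// sqrtr_gt0.
have h2 : (cap c g s (eball (0 : V) 1) < +oo)%E.
  apply: le_lt_trans (le_cap _ s0 (@eball_ball 0 1)) _.
  by apply: le_lt_trans (HC _ _ ltr01) _; rewrite ltry.
exists (fine (cap c g s (eball (0 : V) 1))); last by rewrite fineK// ge0_fin_numE// ltW.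
by apply: fine_gt0; rewrite h1.
Qed.

End capacities.

(** * Covering lemma *)

Section vitali_covering.
Context (R : realType) (n : nat).
Local Notation V := 'rV[R]_n.
Local Notation mu := (lebesgue_rV R n).
Implicit Types (x y z : V) (a r s : R) (rad : V -> R) (G D : set V).

Lemma near_sup_radius rad G M : G !=set0 -> (forall x, G x -> 0 < rad x) ->
  (forall x, G x -> rad x <= M) ->
  exists2 z, G z & forall x, G x -> rad x <= 2 * rad z.
Proof.
move=> [w Gw] rad0 radM.
have hsup : has_sup (rad @` G).
  by split; [exists (rad w), w|exists M => _ [x Gx <-]; exact: radM].
pose S := sup (rad @` G).
have supS x : G x -> rad x <= S.
  by move=> Gx; apply: sup_upper_bound => //; exists x.
have S0 : 0 < S by exact: lt_le_trans (rad0 w Gw) (supS w Gw).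
have [_ [z Gz <-] Sz] := sup_adherent (divr_gt0 S0 (ltr0n _ 2)) hsup.
exists z => // x Gx; apply: le_trans (supS x Gx) _.
by rewrite -/S in Sz; lra.
Qed.

(* A disjoint subfamily, maximal among those which meet every ball they meet in
   a ball of at least half its radius. *)
Lemma vitali_covering rad G M : (forall x, G x -> 0 < rad x) ->
  (forall x, G x -> rad x <= M) ->
  exists D, [/\ D `<=` G, trivIset D (fun z => ball z (rad z)) &
    forall x, G x -> exists2 z, D z & ball z (5 * rad z) x].
Proof.
move=> rad0 radM.
pose B z : set V := ball z (rad z).
pose P D := [/\ D `<=` G, trivIset D B & forall x, G x ->
  (exists2 z, D z & B x `&` B z !=set0) ->
  exists z, [/\ D z, B x `&` B z !=set0 & rad x <= 2 * rad z]].
have [D [[DG tD DP] maxD]] : exists D, P D /\ forall D', D `<` D' -> ~ P D'.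
  (* Each condition involves at most two members of the union, or one witness, and so is inherited
     from a single member of the chain. *)
  apply: Zorn_bigcup => F FP totF; split.
  - by move=> x [X FX Xx]; have [XG _ _] := FP X FX; exact: XG.
  - move=> z z' [X FX Xz] [Y FY Yz']; have [_ tX _] := FP X FX; have [_ tY _] := FP Y FY.
    have [XY|YX] := totF X Y FX FY.
      by apply: tY => //; exact: XY.
    by apply: tX => //; exact: YX.
  - move=> x Gx [z [X FX Xz] xz]; have [_ _ XP] := FP X FX.
    have [|z' [Xz' xz' rxz']] := XP x Gx; first by exists z.
    by exists z'; split => //; exists X.
have Bxx x : G x -> B x x by move=> Gx; apply: ballxx; exact: rad0.
suff meets x : G x -> exists2 z, D z & B x `&` B z !=set0.
  exists D; split => // x Gx; have [z [Dz [w [xw zw]] xz]] := DP x Gx (meets x Gx).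
  exists z => //; have z0 := rad0 z (DG z Dz).
  (* Only the centre [x] has to be covered, and its distance to [z] is below
     [rad z + rad x <= 3 * rad z]. *)
  apply: (@le_ball _ _ z (rad z + rad x)); first by lra.
  exact: ball_triangle zw (ball_sym xw).
move=> Gx; apply: contrapT => xD; move: x Gx xD => x0 Gx0 x0D.
(* If some ball meets no selected one, then among such balls one of nearly maximal radius can be
   added to [D], against maximality. *)
pose W := [set x | G x /\ ~ exists2 z, D z & B x `&` B z !=set0].
have [z [Gz zD] Wz] := @near_sup_radius rad W M (ex_intro _ x0 (conj Gx0 x0D))
  (fun x Wx => rad0 x Wx.1) (fun x Wx => radM x Wx.1).
apply: (maxD (D `|` [set z])).
  split; first by move=> x Dx; left.
  move=> /(_ z (or_intror erefl)) Dz; apply: zD; exists z => //.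
  by exists z; split; exact: Bxx.
split.
- by move=> x [/DG//|->].
- move=> x y [Dx|->] [Dy|->] xy => //.
  + exact: tD.
  + by exfalso; apply: zD; exists x => //; rewrite setIC.
  + by exfalso; apply: zD; exists y.
- move=> x Gx [y yDz xy].
  have [xD|xD] := pselect (exists2 z, D z & B x `&` B z !=set0).
    by have [w [Dw xw rxw]] := DP x Gx xD; exists w; split => //; left.
  exists z; split; [by right| |exact: Wz].
  by case: yDz => [Dy|<-//]; exfalso; apply: xD; exists y.
Qed.

(** Disjoint balls contain distinct rational points, which [pickle] numbers. Countability takes the
    form of an injective numbering of [D], ready for series indexed by [nat]. *)
Lemma disjoint_balls_countable rad D : (forall z, D z -> 0 < rad z) ->
  trivIset D (fun z => ball z (rad z)) ->
  exists f : V -> nat, forall z z', D z -> D z' -> f z = f z' -> z = z'.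
Proof.
move=> rad0 tD.
have H z : exists q : 'rV[rat]_n, D z -> ball z (rad z) (map_mx ratr q).
  have [Dz|Dz] := pselect (D z); last by exists 0.
  have r0 := rad0 z Dz.
  have K i : exists q : rat, ball (z 0 i) (rad z) (ratr q : R).
    have [|q] := @rat_in_itvoo R (z 0 i - rad z) (z 0 i + rad z); first by lra.
    rewrite in_itv/= => /andP[q1 q2]; exists q.
    by rewrite -ball_normE/= ltr_norml; apply/andP; split; lra.
  have [q qP] := choice K.
  exists (\row_i q i) => _; rewrite ball_rowE// => i; rewrite !mxE; exact: qP.
have [q qP] := choice H.
exists (pickle \o q) => z z' Dz Dz' /= /(pcan_inj pickleK) qq.
apply: (tD z z' Dz Dz'); exists (map_mx ratr (q z)); split; first exact: qP.
by rewrite qq; exact: qP.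
Qed.

Lemma riesz_cap0 a s : 0 < a -> a < n%:R -> 0 < s -> riesz_cap a s (set0 : set V) = 0%E.
Proof.
move=> a0 an s0; apply/eqP; rewrite eq_le riesz_cap_ge0// andbT.
apply: le_trans (@riesz_cap_le _ _ a s _ (fun=> 0) s0 _) _; first by split.
by rewrite /energy powR0 ?gt_eqF// integral0.
Qed.

(** By Vitali's lemma selected balls, enlarged five times, cover [G]. The capacity of each is at
    most a constant over [b] times the integral of [g] over the original ball, and the original
    balls are disjoint. *)
Lemma riesz_cap_covering a s : 0 < a -> a < n%:R -> 0 < s -> a * s < n%:R ->
  exists2 C : R, 0 < C & forall (g : V -> \bar R) (b : R) G,
  measurable_fun setT g -> (forall y, 0 <= g y)%E -> 0 < b ->
  (forall x, G x -> exists2 r : R, 0 < r &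
    ((b * r `^ (n%:R - a * s))%:E <= \int[mu]_(y in ball x r) g y)%E) ->
  (riesz_cap a s G <= (C / b)%:E * \int[mu]_y g y)%E.
Proof.
move=> a0 an s0 asn; have das : 0 < n%:R - a * s by rewrite subr_gt0.
have [C C0 HC] := @riesz_cap_ball_le R n a s a0 an s0.
pose C' := C * 5 `^ (n%:R - a * s).
have C'0 : 0 < C' by rewrite mulr_gt0 ?powR_gt0.
exists C' => // g b G mg g0 b0 HG.
have : (0 <= \int[mu]_y g y)%E by exact: integral_ge0.
case intg : (\int[mu]_y g y)%E => [I| |]// I0; last first.
  by rewrite gt0_muley ?leey// lte_fin divr_gt0.
have H x : exists r : R, G x -> 0 < r /\
    ((b * r `^ (n%:R - a * s))%:E <= \int[mu]_(y in ball x r) g y)%E.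
  have [Gx|Gx] := pselect (G x); last by exists 0.
  by have [r r0 rg] := HG x Gx; exists r.
have {H}[rad radP] := choice H.
have rad0 x : G x -> 0 < rad x by move=> /radP[].
have mB z : measurable (ball z (rad z) : set V) by exact: measurable_row_ball.
(* The integral over one ball is at most the finite total [I]; this bounds the radii, as the
   covering lemma requires. *)
have radM x : G x -> rad x <= (I / b) `^ (n%:R - a * s)^-1.
  move=> Gx; have [r0] := radP x Gx.
  move=> /le_trans/(_ (ge0_subset_integral mu (mB x) measurableT mg
    (fun y _ => g0 y) (@subsetT _ _))); rewrite intg lee_fin => bI.
  have -> : rad x = (rad x `^ (n%:R - a * s)) `^ (n%:R - a * s)^-1.
    by rewrite -powRrM divff ?gt_eqF// powRr1// ltW.
  rewrite ge0_ler_powR ?invr_ge0 ?(ltW das) ?nnegrE ?powR_ge0//.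
    by rewrite divr_ge0 ?(ltW b0).
  by rewrite ler_pdivlMr// mulrC.
have [D [DG tD GD]] := vitali_covering rad0 radM.
have [f finj] := disjoint_balls_countable (fun z Dz => rad0 z (DG z Dz)) tD.
(* The selected balls, scaled by [l], are indexed by natural numbers; indices without a ball give
   the empty set. *)
pose F (l : R) k : set V := \bigcup_(z in D `&` [set z | f z = k]) ball z (l * rad z).
have FE l z : D z -> F l (f z) = ball z (l * rad z).
  move=> Dz; apply/seteqP; split => [y [z' [Dz' /= fz'] ?]|y ?]; last by exists z.
  by rewrite (finj _ _ Dz Dz' (esym fz')).
have F0 l k : ~ (exists2 z, D z & f z = k) -> F l k = set0.
  move=> Dk; apply/seteqP; split => // y [z [Dz fz] _]; by apply: Dk; exists z.
have mF k : measurable (F 1 k).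
  have [[z Dz <-]|Dk] := pselect (exists2 z, D z & f z = k).
    by rewrite FE// mul1r.
  by rewrite F0.
apply: le_trans (@riesz_cap_sigma_subadditive _ _ a s (F 5) _ a0 an s0 _) _.
  move=> x /GD[z Dz xz]; exists (f z) => //; by rewrite FE.
have H k : (riesz_cap a s (F 5%R k) <= (C' / b)%:E * \int[mu]_(y in F 1%R k) g y)%E.
  have [[z Dz <-]|Dk] := pselect (exists2 z, D z & f z = k); last first.
    by rewrite !F0// riesz_cap0// integral_set0 mule0.
  have rz0 := rad0 z (DG z Dz).
  rewrite !FE// mul1r; apply: le_trans (HC z (5 * rad z) _) _; first by rewrite mulr_gt0.
  have [_ radz] := radP z (DG z Dz).
  apply: le_trans (lee_wpmul2l _ radz); last by rewrite lee_fin divr_ge0 ?(ltW b0) ?(ltW C'0).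
  rewrite -EFinM lee_fin powRM ?(ltW rz0)// /C' mulrA.
  by rewrite [leRHS]mulrA divfK ?gt_eqF.
apply: le_trans (lee_nneseries _ (fun k _ => H k)) _.
  by move=> k _ _; exact: riesz_cap_ge0.
rewrite nneseriesZl; last by move=> k _; exact: integral_ge0.
rewrite lee_wpmul2l ?lee_fin ?divr_ge0 ?(ltW b0) ?(ltW C'0)//.
rewrite -ge0_integral_bigcup//.
- rewrite -intg; apply: ge0_subset_integral => //.
  exact: bigcup_measurable.
- exact: measurable_funTS.
- move=> i j _ _ [y [[z [Dz <-] zy] [z' [Dz' <-] z'y]]]; congr f.
  by apply: tD => //; exists y; rewrite !mul1r in zy z'y.
Qed.

End vitali_covering.

(** * Layer-cake estimates along geometric levels *)

Section layers.
Context (R : realType).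
Local Notation mu := (@lebesgue_measure R).
Implicit Types (h : R -> \bar R) (l th : R).

(** Superlevel sets of a monotone function are intervals. The integrands of the Choquet integrals
    below are of this kind. *)
Lemma nonincreasing_emeasurable h (D : set R) :
  measurable (D : set (measurableTypeR R)) ->
  {homo h : u v / u <= v >-> (v <= u)%E} ->
  measurable_fun (D : set (measurableTypeR R)) h.
Proof.
move=> mD hmon; apply: (measurability (@ErealGenCInfty.G R)).
  exact: ErealGenCInfty.measurableE.
move=> _ [_ [r ->] <-]; apply: measurableI => //.
apply: is_interval_measurable => u v /=; rewrite !in_itv/= !andbT => hu hv w /andP[uw wv].
by rewrite in_itv/= andbT (le_trans hv)// hmon.
Qed.

(** An upper Riemann sum: [h] is at most [H0] below [l], and at most its value at the left end on
    each [[l 2^j, l 2^(j+1)[], an interval of length [l 2^j]. *)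
Lemma layer_cake_le h (l : R) (H0 : \bar R) :
  0 < l -> {homo h : u v / u <= v >-> (v <= u)%E} -> (forall u, 0 <= h u)%E ->
  (forall u, 0 < u -> (h u <= H0)%E) ->
  (\int[mu]_(u in `]0%R, +oo[) h u <=
    l%:E * H0 + \sum_(j <oo) ((l * 2 ^+ j)%:E * h (l * 2 ^+ j)%R))%E.
Proof.
move=> l0 hmon h0 hH.
have H00 : (0 <= H0)%E by apply: le_trans (hH 1%R _).
pose I j : set (measurableTypeR R) := [set` `[l * 2 ^+ j, l * 2 ^+ j.+1[].
pose I0 : set (measurableTypeR R) := [set` `]0, l[].
have mI j : measurable (I j) by exact: measurable_itv.
have mI0 : measurable I0 by exact: measurable_itv.
pose g (u : measurableTypeR R) : \bar R := (H0 * (\1_I0 u)%:E + \sum_(j <oo) (h (l * 2 ^+ j)%R * (\1_(I j) u)%:E))%E.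
have mind (A : set (measurableTypeR R)) (e : \bar R) : measurable A ->
    measurable_fun setT (fun u => e * (\1_A u)%:E)%E.
  move=> mA; apply: measurable_funeM.
  by apply/measurable_EFinP; exact/measurable_indicP.
have ind0 (A : set (measurableTypeR R)) (e : \bar R) u : (0 <= e)%E -> (0 <= e * (\1_A u)%:E)%E.
  by move=> e0; rewrite mule_ge0// lee_fin.
have ms : measurable_fun setT (fun u => \sum_(j <oo) (h (l * 2 ^+ j)%R * (\1_(I j) u)%:E))%E.
  apply: ge0_emeasurable_sum; first by move=> j u _ _; exact: ind0.
  by move=> j _; exact: mind.
have s0 u : (0 <= \sum_(j <oo) (h (l * 2 ^+ j)%R * (\1_(I j) u)%:E))%E.
  by apply: nneseries_ge0 => j _ _; exact: ind0.
have intind (A : set (measurableTypeR R)) (e : \bar R) : measurable A -> (0 <= e)%E ->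
    (\int[mu]_u (e * (\1_A u)%:E) = e * mu A)%E.
  move=> mA e0; rewrite ge0_integralZl//.
  - by rewrite integral_indic// setIT.
  - by apply/measurable_EFinP; exact/measurable_indicP.
apply: (@le_trans _ _ (\int[mu]_u g u)%E); last first.
  rewrite ge0_integralD//; last 2 first.
  - by move=> u _; exact: ind0.
  - exact: mind.
  rewrite intind// integral_nneseries//; last 2 first.
  - by move=> j; exact: mind.
  - by move=> j u _; exact: ind0.
  rewrite lebesgue_measure_itv/= lte_fin l0 sube0 muleC leeD2l//.
  rewrite le_eqVlt; apply/orP; left; apply/eqP; apply: eq_eseriesr => j _.
  rewrite intind// lebesgue_measure_itv/= lte_fin.
  have lj : 0 < l * 2 ^+ j by rewrite mulr_gt0// exprn_gt0.
  have E : l * 2 ^+ j.+1 = l * 2 ^+ j + l * 2 ^+ j by rewrite exprS; ring.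
  by rewrite E ltrDr lj -EFinB addrK muleC.
rewrite integral_mkcond; apply: ge0_le_integral => //.
- by move=> u _; exact: erestrict_ge0.
- apply/(measurable_restrictT _ _).1 => //; exact: nonincreasing_emeasurable.
- by apply: emeasurable_funD => //; exact: mind.
move=> u _; rewrite patchE; case: ifPn => [|_]; last by rewrite adde_ge0// ind0.
rewrite inE/= in_itv/= andbT => u0; have [lu|ul] := leP l u.
  have [j /andP[j1 j2]] := dyadic_above l0 lu.
  apply: (@le_trans _ _ (h (l * 2 ^+ j)%R)); first exact: hmon.
  rewrite -[leLHS]add0e leeD// ?ind0//.
  apply: le_trans (nneseries_ge_term (u := fun j => (h (l * 2 ^+ j)%R * (\1_(I j) u)%:E)%E) j _); last first.
    by move=> k; exact: ind0.
  by rewrite indicE mem_set ?mule1 /I/= ?in_itv/= ?j1.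
rewrite -[leLHS]adde0 leeD//.
by rewrite indicE mem_set ?mule1 ?hH /I0/= ?in_itv/= ?u0.
Qed.

(** A lower Riemann sum over disjoint intervals with right ends [l th^j] and lengths
    [(1 - 1/th) l th^j]. The ratio is free because the levels [2^j] of [|f|] become [2^(p j)] for
    [|f|^p]. *)
Lemma layer_cake_ge h (l th : R) :
  0 < l -> 1 < th -> {homo h : u v / u <= v >-> (v <= u)%E} -> (forall u, 0 <= h u)%E ->
  (\sum_(j <oo) ((l * th ^+ j)%:E * h (l * th ^+ j)%R) <=
    (1 - th^-1)^-1%:E * \int[mu]_(u in `]0%R, +oo[) h u)%E.
Proof.
move=> l0 th1 hmon h0; have th0 : 0 < th by exact: lt_trans th1.
have th'0 : 0 < 1 - th^-1 by rewrite subr_gt0 invf_lt1.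
(* The left end is written with [th^-1] because an exponent [j - 1] would be truncated at
   [j = 0]. *)
pose I j : set (measurableTypeR R) := [set` `]th^-1 * (l * th ^+ j), l * th ^+ j]].
have mI j : measurable (I j) by exact: measurable_itv.
have lj j : 0 < l * th ^+ j by rewrite mulr_gt0// exprn_gt0.
have tI : trivIset setT I.
  apply: ltn_trivIset => j i ij; apply/seteqP; split => // u []; rewrite /I/=.
  rewrite !in_itv/= => /andP[_ ui] /andP[ju _].
  have : l * th ^+ i <= th^-1 * (l * th ^+ j).
    rewrite mulrCA ler_pM2l// ler_pdivlMl// -exprS.
    by apply: (ler_weXn2l (ltW th1)).
  by move=> /(le_trans ui)/le_lt_trans/(_ ju); rewrite ltxx.
have mh (A : set (measurableTypeR R)) : measurable A -> measurable_fun A h.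
  by move=> mA; exact: nonincreasing_emeasurable.
apply: (@le_trans _ _ ((1 - th^-1)^-1%:E * \int[mu]_(u in \bigcup_j I j) h u)%E); last first.
  rewrite lee_wpmul2l ?lee_fin ?invr_ge0 ?(ltW th'0)//.
  apply: ge0_subset_integral => //.
  - exact: bigcup_measurable.
  - exact: mh.
  - move=> u [j _]; rewrite /I/= !in_itv/= andbT => /andP[+ _].
    by apply: lt_trans; rewrite mulr_gt0 ?invr_gt0.
rewrite ge0_integral_bigcup//; last by apply: mh; apply: bigcup_measurable.
rewrite -nneseriesZl; last by move=> j _; exact: integral_ge0.
apply: lee_nneseries => j _; first by move=> _; rewrite mule_ge0 ?lee_fin// ltW.
apply: (@le_trans _ _ ((1 - th^-1)^-1%:E * \int[mu]_(u in I j) (cst (h (l * th ^+ j)%R) u))%E).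
  have mIj : mu (I j) = ((1 - th^-1) * (l * th ^+ j))%:E.
    rewrite lebesgue_measure_itv/= lte_fin gtr_pMl ?invf_lt1// th1 -EFinB.
    by rewrite mulrBl mul1r.
  have -> : (\int[mu]_(u in I j) (cst (h (l * th ^+ j)%R) u) =
      h (l * th ^+ j)%R * ((1 - th^-1) * (l * th ^+ j))%:E)%E.
    by rewrite -mIj; exact: integral_cst.
  by rewrite muleCA -EFinM mulKf ?gt_eqF// muleC.
rewrite lee_wpmul2l ?lee_fin ?invr_ge0 ?(ltW th'0)//.
apply: (@ge0_le_integral _ _ R mu (I j) (mI j)); [by move=> u _; exact: h0|exact: measurable_cst|exact: mh|].
by move=> u; rewrite /I/= in_itv/= => /andP[_ ul]; exact: hmon.
Qed.

(** Every term is at most the sum [S], so [u_j^q <= S^(q-1) u_j]. *)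
Lemma nneseries_poweR (u : (\bar R)^nat) (q : R) : 1 <= q -> (forall j, 0 <= u j)%E ->
  (\sum_(j <oo) (u j `^ q) <= (\sum_(j <oo) u j) `^ q)%E.
Proof.
move=> q1 u0; have q0 : 0 < q by exact: lt_le_trans q1.
have : (0 <= \sum_(j <oo) u j)%E by exact: nneseries_ge0.
case US : (\sum_(j <oo) u j)%E => [S| |]// S0; last first.
  by rewrite poweRyr ?gt_eqF// leey.
have {}S0 : 0 <= S by rewrite -lee_fin.
have uS j : (u j <= S%:E)%E by rewrite -US; exact: nneseries_ge_term.
apply: (@le_trans _ _ (\sum_(j <oo) ((S `^ (q - 1))%:E * u j))%E).
  apply: lee_nneseries => j _; first by move=> _; exact: poweR_ge0.
  have := uS j; have := u0 j; case: (u j) => [v| |]//; rewrite !lee_fin => v0 vS.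
  have [->|vN] := eqVneq v 0; first by rewrite mulr0 powR0 ?gt_eqF.
  rewrite -[in leLHS](subrK 1 q).
  rewrite [leLHS]powRD ?vN ?implybT// powRr1// ler_wpM2r//.
  by rewrite ge0_ler_powR ?subr_ge0 ?nnegrE.
rewrite nneseriesZl// US poweR_EFin -EFinM lee_fin.
have [->|SN] := eqVneq S 0; first by rewrite mulr0 powR_ge0.
rewrite -{2}(powRr1 S0) -powRD ?SN ?implybT// subrK//.
Qed.

End layers.

(** * Level sets of the maximal function *)

Section weak_type.
Context (R : realType) (n : nat).
Local Notation V := 'rV[R]_n.
Local Notation mu := (lebesgue_rV R n).
Implicit Types (x y z : V) (a g r s : R) (phi : V -> R) (E D : set V).

(* The part of the potential coming from outside [ball x (2 * r)] is, up to a
   constant, the same at all points of [ball x r]. *)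
Lemma localized_tests a : 0 < a -> a < n%:R ->
  exists2 C : R, 0 < C & forall phi E x r, 0 < r -> tests a phi E ->
  (riesz_potential a (fun y => C * phi y)%R x < 1)%E ->
  tests a (fun y => 2 * (phi y * \1_(ball x (2 * r) : set V) y)) (E `&` ball x r).
Proof.
move=> a0 an; have n0 : 0 < n%:R :> R by exact: lt_trans an.
(* [h] is the constant of [riesz_kernel_le_scale] for distances of ratio 2. If the potential of
   [2 h phi] at [x] is below 1, the far part at any [z] of [ball x r] is at most 1/2. *)
pose h := (Num.sqrt n%:R * 2) `^ (n%:R - a).
have h0 : 0 < h by rewrite powR_gt0// mulr_gt0// sqrtr_gt0.
exists (2 * h); first by rewrite mulr_gt0.
move=> phi E x r r0 [mphi phi0 phiE] potx.
have mB : measurable (ball x (2 * r) : set V) by exact: measurable_row_ball.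
have mind : measurable_fun setT (fun y => phi y * \1_(ball x (2 * r) : set V) y).
  by apply: measurable_funM => //; exact/measurable_indicP.
have ind0 y : 0 <= phi y * \1_(ball x (2 * r) : set V) y by rewrite mulr_ge0.
split => [|y|z [Ez xz]]; [exact: measurable_funM|exact: mulr_ge0|].
rewrite riesz_potentialZ//.
have k0 (w y : V) : (0 <= riesz_kernel a w * (phi y)%:E)%E.
  by rewrite mule_ge0 ?lee_fin ?riesz_kernel_ge0.
have far : (\int[mu]_(y in ~` ball x (2 * r)) (riesz_kernel a (z - y) * (phi y)%:E) <=
    2^-1%:E)%E.
  apply: (@le_trans _ _ (\int[mu]_(y in ~` ball x (2 * r))
      (h%:E * (riesz_kernel a (x - y) * (phi y)%:E)))%E).
    apply: (@ge0_le_integral _ _ R mu _ (measurableC mB)).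
    - by move=> y _; exact: k0.
    - exact: measurable_funTS (measurable_potential _ _ mphi).
    - exact: measurable_funeM (measurable_funTS (measurable_potential _ _ mphi)).
    move=> y; rewrite /= ballN => /negP; rewrite -leNgt => xy.
    rewrite muleA lee_wpmul2r ?lee_fin//; apply: riesz_kernel_le_scale => //.
    move: xz; rewrite ballN => xz.
    have := ler_normD (x - z) (z - y); rewrite addrA subrK; lra.
  apply: (@le_trans _ _ (\int[mu]_y (h%:E * (riesz_kernel a (x - y) * (phi y)%:E)))%E).
    apply: ge0_subset_integral => //.
    - exact: measurableC.
    - by apply: measurable_funeM; exact: measurable_potential.
    - by move=> y _; apply: mule_ge0; [rewrite lee_fin ltW|exact: k0].
  have potE : riesz_potential a (fun y => 2 * h * phi y) x =
      (2%:E * \int[mu]_y (h%:E * (riesz_kernel a (x - y) * (phi y)%:E)))%E.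
    rewrite riesz_potentialZ ?mulr_ge0 ?(ltW h0)// EFinM -muleA; congr (_ * _)%E.
    rewrite ge0_integralZl ?lee_fin ?(ltW h0)//.
    exact: measurable_potential.
  move: potx; rewrite potE => /ltW potx.
  by rewrite -[leRHS]mul1e -[leRHS]muleC lee_pdivlMl.
have := phiE z Ez.
rewrite (riesz_potential_split z mB)//.
have -> : riesz_potential a (fun y => phi y * \1_(ball x (2 * r) : set V) y) z =
    (\int[mu]_(y in ball x (2 * r)) (riesz_kernel a (z - y) * (phi y)%:E))%E.
  rewrite -integral_indic_mull; apply: eq_integral => y _.
  by rewrite EFinM (muleA (riesz_kernel a _)) muleC.
move=> /le_trans/(_ (leeD2l _ far)); rewrite -leeBlDr// -EFinB.
have -> : 1 - 2^-1 = 2^-1 :> R by field.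
have two0 : (0 <= 2%:E :> \bar R)%E by rewrite lee_fin.
by move=> /(lee_wpmul2l two0); rewrite -EFinM divff.
Qed.

Lemma energy_localized phi s (B : set V) : measurable_fun setT phi ->
  (forall y, 0 <= phi y) -> 0 < s -> measurable B ->
  energy s (fun y => 2 * (phi y * \1_B y)) =
    ((2 `^ s)%:E * \int[mu]_(y in B) (phi y `^ s)%:E)%E.
Proof.
move=> mphi phi0 s0 mB.
have mind : measurable_fun setT (fun y => phi y * \1_B y).
  by apply: measurable_funM => //; exact/measurable_indicP.
have ind0 y : 0 <= phi y * \1_B y by rewrite mulr_ge0.
rewrite (energyZ s mind ind0 (ler0n _ 2)); congr (_ * _)%E.
rewrite -integral_indic_mull; apply: eq_integral => y _.
by rewrite indicE; case: (y \in B); rewrite /= ?mulr1 ?mulr0 ?mul1e ?mul0e ?powR0 ?gt_eqF.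
Qed.

Lemma riesz_capU a s E D : 0 < a -> a < n%:R -> 0 < s ->
  (riesz_cap a s (E `|` D) <= riesz_cap a s E + riesz_cap a s D)%E.
Proof.
move=> a0 an s0; pose F k := if k == 0%N then E else if k == 1%N then D else set0.
apply: le_trans (@riesz_cap_sigma_subadditive R n a s F (E `|` D) a0 an s0 _) _.
  by move=> x [Ex|Dx]; [exists 0%N|exists 1%N].
rewrite (nneseries_split 0 2); last by move=> k _; exact: riesz_cap_ge0.
rewrite eseries0 ?adde0; last first.
  by move=> [|[|k]]//= _ _; rewrite /F/= riesz_cap0.
by rewrite add0n big_nat_recr//= big_nat1.
Qed.

End weak_type.

(** * The dyadic weak-type estimate *)

Section dyadic_weak_type.
Context (R : realType) (n : nat).
Local Notation V := 'rV[R]_n.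
Local Notation mu := (lebesgue_rV R n).
Implicit Types (x y z : V) (a g r s t : R) (phi : V -> R) (E D : set V).

Definition superlevel D (f : V -> R) (u : R) : set V := [set y | D y /\ u < `|f y|].

(** For a radius whose average exceeds [t], the Choquet integral is replaced by a dyadic sum; the
    levels below [l t] are estimated by the capacity of the whole ball. *)
Lemma cap_maximal_gt (c g s : R) : 0 < c -> 0 <= g -> g < n%:R -> 1 < s ->
  g * s < n%:R ->
  exists K l : R, [/\ 0 < K, 0 < l & forall D f x t, 0 < t ->
  (t%:E < cap_maximal c g s D f x)%E -> exists2 r, 0 < r &
  ((K * t * r `^ (n%:R - g * s))%:E <= \sum_(j <oo) ((l * t * 2 ^+ j)%:E *
     cap c g s (superlevel D f (l * t * 2 ^+ j) `&` ball x r)))%E].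
Proof.
move=> c0 g0 gn s1 gsn; have s0 : 0 < s by exact: lt_trans s1.
have [k k0 kE] := cap_unit_eball c0 g0 gn s1 gsn.
have [A A0 HA] := @cap_ball_le R n c c0 g s g0 gn s0.
(* With this [l] the levels below [l t] contribute at most [l t A rho], half of [k t rho], where
   [rho] is the power of [r]; the other half is the left-hand side. *)
exists (k / 2), (k / (2 * A)); split; [by rewrite divr_gt0|by rewrite divr_gt0// mulr_gt0|].
move=> D f x t t0 /ereal_sup_gt[_ [r /= r0 <-]].
set rho := r `^ (n%:R - g * s); have rho0 : 0 < rho by rewrite powR_gt0.
rewrite kE -EFinM inver gt_eqF ?mulr_gt0// lte_pdivlMr ?mulr_gt0// -EFinM.
rewrite /choquet_on /choquet => lt_int; exists r => //.
set l := k / (2 * A) * t; have l0 : 0 < l by rewrite !mulr_gt0 ?invr_gt0 ?mulr_gt0.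
pose h u := cap c g s [set y | D y /\ (u%:E < `|f y|%:E * (\1_(eball x r) y)%:E)%E].
have hmon : {homo h : u v / u <= v >-> (v <= u)%E}.
  move=> u v uv; apply: le_cap => // y /= [Dy vy]; split => //.
  by apply: le_lt_trans vy; rewrite lee_fin.
have h0 u : (0 <= h u)%E by exact: cap_ge0.
(* Here the Euclidean ball of the maximal function is enlarged to the sup-norm ball of the same
   radius. *)
have hsub u : 0 < u -> [set y | D y /\ (u%:E < `|f y|%:E * (\1_(eball x r) y)%:E)%E] `<=`
    superlevel D f u `&` ball x r.
  move=> u0 y [Dy]; rewrite indicE; have [|yB] := boolP (y \in eball x r).
    by rewrite inE => /eball_ball xy; rewrite mule1 lte_fin.
  by rewrite mule0 lte_fin ltNge (ltW u0).
have hA u : 0 < u -> (h u <= (A * rho)%:E)%E.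
  move=> u0; apply: le_trans (HA x r r0); apply: le_cap => //.
  by move=> y /(hsub u u0)[].
have := lt_le_trans lt_int (layer_cake_le l0 hmon h0 hA).
rewrite -EFinM (_ : l * (A * rho) = k / 2 * t * rho); last first.
  by rewrite /l; field; rewrite gt_eqF.
rewrite -lteBlDl// -EFinB (_ : t * (k * rho) - _ = k / 2 * t * rho); last by field.
move=> /ltW/le_trans; apply; apply: lee_nneseries => j _.
  by move=> _; rewrite mule_ge0// lee_fin mulr_ge0 ?exprn_ge0// ltW.
have lj : 0 < l * 2 ^+ j by rewrite mulr_gt0// exprn_gt0.
by rewrite lee_wpmul2l ?lee_fin ?(ltW lj)//; apply: le_cap => //; exact: hsub.
Qed.

(** Since [p q = 1], the weight can be moved inside the power, which prepares the use of
    [nneseries_poweR]. *)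
Lemma weighted_poweR (g a s w : R) (e : \bar R) :
  0 < w -> (0 <= e)%E -> g * s < n%:R -> a * s < n%:R ->
  let p := (n%:R - a * s) / (n%:R - g * s) in
  let q := (n%:R - g * s) / (n%:R - a * s) in
  (w%:E * e `^ q = ((w `^ p)%:E * e) `^ q)%E.
Proof.
move=> w0 e0 gsn asn p q.
have gs0 : n%:R - g * s != 0 by rewrite gt_eqF// subr_gt0.
have as0 : n%:R - a * s != 0 by rewrite gt_eqF// subr_gt0.
rewrite poweRM ?lee_fin ?powR_ge0// poweR_EFin -powRrM.
have -> : p * q = 1 by rewrite /p /q; field; rewrite ?gs0 ?as0.
by rewrite powRr1// ltW.
Qed.

(** The level set splits into an exceptional part, bounded by subadditivity, and a remainder [G] on
    which test functions can be localized and the covering lemma applies to the density [d]. *)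
Lemma cap_maximal_dyadic (c g a s : R) : 0 < c -> 0 <= g -> g < a -> a < n%:R ->
  1 < s -> a * s < n%:R -> let p := (n%:R - a * s) / (n%:R - g * s) in
  exists C l : R, [/\ 0 < C, 0 < l & forall D f t, 0 < t ->
  (riesz_cap a s [set x : V | (t%:E < cap_maximal c g s D f x)%E] <=
   C%:E * \sum_(j <oo) (((2 ^+ j) `^ p)%:E *
     riesz_cap a s (superlevel D f (l * t * 2 ^+ j))))%E].
Proof.
move=> c0 g0 ga an s1 asn p.
have a0 : 0 < a by exact: le_lt_trans ga.
have gn : g < n%:R by exact: lt_trans an.
have s0 : 0 < s by exact: lt_trans s1.
have gsn : g * s < n%:R by rewrite (lt_trans _ asn)// ltr_pM2r.
have das : 0 < n%:R - a * s by rewrite subr_gt0.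
have dgs : 0 < n%:R - g * s by rewrite subr_gt0.
have p0 : 0 < p by rewrite divr_gt0.
pose q := (n%:R - g * s) / (n%:R - a * s).
have q0 : 0 < q by rewrite divr_gt0.
have q1 : 1 <= q by rewrite ler_pdivlMr// mul1r lerD2l lerN2 ler_pM2r// ltW.
have qp : q * p = 1 by rewrite /p /q; field; rewrite !gt_eqF.
have [K [l [K0 l0 Hmax]]] := cap_maximal_gt c0 g0 gn s1 gsn.
have [A A0 HA] := isocapacitary c0 g0 ga an s1 asn.
have [C0 C00 Hloc] := @localized_tests R n a a0 an.
have [Cc Cc0 Hcov] := @riesz_cap_covering R n a s a0 an s0 asn.
(* [(K / A)^p] results from raising the isocapacitary estimate to the power [p]; the other factor
   compensates for the passage to radius [2 r]. *)
pose b := (K / A) `^ p * 2 `^ (- (n%:R - a * s)).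
have b0 : 0 < b by rewrite mulr_gt0 ?powR_gt0 ?divr_gt0.
(* The first summand pays for the exceptional set, the second for the covering. *)
pose C2 := C0 `^ s / l `^ p + Cc / b * 2 `^ s.
have C20 : 0 < C2.
  by rewrite addr_gt0// ?mulr_gt0 ?invr_gt0 ?powR_gt0.
exists (C2 * l `^ p), l; split => //; first by rewrite mulr_gt0 ?powR_gt0.
move=> D f t t0; set T := t `^ p; have T0 : 0 < T by rewrite powR_gt0.
set S := (\sum_(j <oo) _)%E.
have S0 : (0 <= S)%E.
  by apply: nneseries_ge0 => j _ _; rewrite mule_ge0 ?riesz_cap_ge0// lee_fin powR_ge0.
(* Finiteness of [S] makes each capacity finite, so that almost optimal test functions exist. *)
have [->|Sfin] := eqVneq S +oo%E.
  by rewrite gt0_muley ?leey// lte_fin mulr_gt0 ?powR_gt0.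
apply/lee_addgt0Pr => eps eps0.
(* Chosen so that the final error [C2 / T * e] equals [eps]. *)
pose e := eps * T / C2; have e0 : 0 < e by rewrite divr_gt0 ?mulr_gt0.
pose E j := superlevel D f (l * t * 2 ^+ j).
pose w j := (l * t * 2 ^+ j) `^ p.
have lj j : 0 < l * t * 2 ^+ j by rewrite !mulr_gt0 ?exprn_gt0.
have w0 j : 0 < w j by rewrite powR_gt0.
have wE j : w j = l `^ p * T * (2 ^+ j) `^ p.
  by rewrite /w !powRM ?mulr_ge0 ?exprn_ge0 ?(ltW l0) ?(ltW t0).
(* The error is prescribed after weighting by [w j], so that all errors add up to [e]. *)
have H j : exists phi, tests a phi (E j) /\
    ((w j)%:E * energy s phi <= (w j)%:E * riesz_cap a s (E j) + (e / (2 ^ j.+1)%:R)%:E)%E.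
  have d0 : 0 < e / (2 ^ j.+1)%:R / w j by rewrite divr_gt0// divr_gt0// ltr0n expn_gt0.
  have [phi tphi phiE] : exists2 phi, tests a phi (E j) &
      (energy s phi < riesz_cap a s (E j) + (e / (2 ^ j.+1)%:R / w j)%:E)%E.
    apply: riesz_cap_lt => //; rewrite lteDl ?lte_fin//.
    rewrite ge0_fin_numE ?riesz_cap_ge0// ltey; apply: contra_neq Sfin => Ej.
    apply/eqP; rewrite -leye_eq.
    apply: le_trans (nneseries_ge_term (u := fun j => (((2 ^+ j) `^ p)%:E *
      riesz_cap a s (superlevel D f (l * t * 2 ^+ j)))%E) j _).
      by rewrite -/(E j) Ej gt0_muley// lte_fin powR_gt0// exprn_gt0.
    by move=> k; rewrite mule_ge0 ?riesz_cap_ge0// lee_fin powR_ge0.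
  exists phi; split => //; apply: le_trans (lee_wpmul2l _ (ltW phiE)) _.
    by rewrite lee_fin ltW.
  rewrite ge0_muleDr ?riesz_cap_ge0 ?lee_fin ?(ltW d0)// -EFinM.
  by rewrite mulrC divfK ?gt_eqF.
have {H} [phi phiP] := choice H.
have tphi j := (phiP j).1; have {}phiP j := (phiP j).2.
have mphi j : measurable_fun setT (phi j) by case: (tphi j).
have phi0 j y : 0 <= phi j y by case: (tphi j).
pose W := (\sum_(j <oo) ((w j)%:E * energy s (phi j)))%E.
have WS : (W <= (l `^ p * T)%:E * S + e%:E)%E.
  apply: (@le_trans _ _ (\sum_(j <oo) ((w j)%:E * riesz_cap a s (E j) + (e / (2 ^ j.+1)%:R)%:E))%E).
    apply: lee_nneseries => j _; last exact: phiP.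
    by move=> _; rewrite mule_ge0 ?energy_ge0// lee_fin ltW.
  apply: le_trans (epsilon_trick _ _ (ltW e0)) _.
    by move=> j; rewrite mule_ge0 ?riesz_cap_ge0// lee_fin ltW.
  rewrite leeD2r// -nneseriesZl; last first.
    by move=> j _; rewrite mule_ge0 ?riesz_cap_ge0// lee_fin powR_ge0.
  rewrite le_eqVlt; apply/orP; left; apply/eqP; apply: eq_eseriesr => j _.
  by rewrite muleA -EFinM -wE.
(* [C0 * phi j] is a test function for [N j] by construction, and outside [N j] the tests can be
   localized. *)
pose N j := [set x | (1 <= riesz_potential a (fun y => (C0 * phi j y)%R) x)%E].
pose G := [set x | (t%:E < cap_maximal c g s D f x)%E] `\` \bigcup_j N j.
have capN : (riesz_cap a s (\bigcup_j N j) <= (C0 `^ s / (l `^ p * T))%:E * W)%E.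
  apply: le_trans (@riesz_cap_sigma_subadditive R n a s N _ a0 an s0 (@subset_refl _ _)) _.
  rewrite -nneseriesZl; last first.
    by move=> j _; rewrite mule_ge0 ?energy_ge0// lee_fin ltW.
  apply: lee_nneseries => j _; first by move=> _; exact: riesz_cap_ge0.
  apply: le_trans (@riesz_cap_le R n a s (N j) (fun y => C0 * phi j y) s0 _) _.
    split => // [|y]; first exact: measurable_funM.
    by rewrite mulr_ge0// ltW.
  rewrite (energyZ s (mphi j) (phi0 j) (ltW C00)) muleA lee_wpmul2r ?energy_ge0//.
  rewrite -EFinM lee_fin wE mulrA divfK ?gt_eqF ?mulr_gt0 ?powR_gt0//.
  (* [(2^j)^p >= 1], that is [w j >= l^p T], so the unweighted energies are controlled by [W]. *)
  rewrite ler_peMr ?powR_ge0// -[leLHS](powRr0 (2 ^+ j)) ler_powR ?exprn_ege1 ?ler1n//.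
  exact: ltW.
pose d y := (\sum_(j <oo) ((2 `^ s * w j)%:E * (phi j y `^ s)%:E))%E.
have t0' j : (0 <= (2 `^ s * w j)%:E)%E by rewrite lee_fin mulr_ge0 ?powR_ge0.
have dens0 j y : (0 <= (phi j y `^ s)%:E)%E by rewrite lee_fin powR_ge0.
have d0 y : (0 <= d y)%E by apply: nneseries_ge0 => j _ _; exact: mule_ge0.
have mdens j : measurable_fun setT (fun y => (2 `^ s * w j)%:E * (phi j y `^ s)%:E)%E.
  by apply: measurable_funeM; exact: measurable_energy_density.
have md : measurable_fun setT d.
  by apply: ge0_emeasurable_sum => // j y _ _; exact: mule_ge0.
have intd (B : set V) : measurable B -> (\int[mu]_(y in B) d y =
    \sum_(j <oo) ((w j)%:E * ((2 `^ s)%:E * \int[mu]_(y in B) (phi j y `^ s)%:E)))%E.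
  move=> mB; rewrite integral_nneseries//; last 2 first.
  - by move=> j; exact: measurable_funTS (mdens j).
  - by move=> j y _; exact: mule_ge0.
  apply: eq_eseriesr => j _.
  have mj := measurable_funTS (D := B) (measurable_energy_density s (mphi j)).
  rewrite (ge0_integralZl mu mB mj (fun y _ => dens0 j y) (t0' j)).
  by rewrite mulrC EFinM muleA.
have intdT : (\int[mu]_y d y = (2 `^ s)%:E * W)%E.
  rewrite intd// -nneseriesZl; last first.
    by move=> j _; rewrite mule_ge0 ?energy_ge0// lee_fin ltW.
  by apply: eq_eseriesr => j _; rewrite muleCA.
have capG : (riesz_cap a s G <= (Cc / (b * T))%:E * ((2 `^ s)%:E * W))%E.
  rewrite -intdT; apply: Hcov => //; first exact: mulr_gt0.
  move=> x [tx xN]; have [r r0 Hr] := Hmax D f x t t0 tx.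
  exists (2 * r); first exact: mulr_gt0.
  have mB : measurable (ball x (2 * r) : set V) by exact: measurable_row_ball.
  set I := (\int[mu]_(y in ball x (2 * r)) d y)%E.
  have I0 : (0 <= I)%E by exact: integral_ge0.
  have capj j : (cap c g s (E j `&` ball x r) <=
      A%:E * ((2 `^ s)%:E * \int[mu]_(y in ball x (2 * r)) (phi j y `^ s)%:E) `^ q)%E.
    rewrite -(energy_localized (mphi j) (phi0 j) s0 mB); apply: HA.
    apply: Hloc => //; rewrite ltNge; apply/negP => Nx; apply: xN; by exists j.
  have e0' j : (0 <= (2 `^ s)%:E * \int[mu]_(y in ball x (2 * r)) (phi j y `^ s)%:E)%E.
    by rewrite mule_ge0 ?lee_fin ?powR_ge0//; exact: integral_ge0.
  (* The isocapacitary inequality is used at each level, the weights move inside the power, and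
     superadditivity of the power [q] collects the sum over [j]. *)
  have : ((K * t * r `^ (n%:R - g * s))%:E <= A%:E * I `^ q)%E.
    apply: le_trans Hr _; rewrite /I intd//.
    apply: le_trans (lee_wpmul2l _ (nneseries_poweR q1 _)); last 2 first.
    - by rewrite lee_fin ltW.
    - by move=> j; rewrite mule_ge0// lee_fin ltW.
    rewrite -nneseriesZl; last by move=> j _; exact: poweR_ge0.
    apply: lee_nneseries => j _.
      by move=> _; rewrite mule_ge0 ?cap_ge0// lee_fin ltW.
    apply: le_trans (lee_wpmul2l _ (capj j)) _; first by rewrite lee_fin ltW.
    by rewrite muleCA (weighted_poweR (lj j) (e0' j) gsn asn).
  have rE : b * T * (2 * r) `^ (n%:R - a * s) = (A^-1 * (K * t * r `^ (n%:R - g * s))) `^ p.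
    have K1 : 0 <= K / A by rewrite divr_ge0 ?(ltW K0) ?(ltW A0).
    have -> : A^-1 * (K * t * r `^ (n%:R - g * s)) = K / A * t * r `^ (n%:R - g * s) by ring.
    rewrite (powRM _ (mulr_ge0 K1 (ltW t0)) (powR_ge0 _ _)) (powRM _ K1 (ltW t0)).
    rewrite -powRrM (_ : (n%:R - g * s) * p = n%:R - a * s); last first.
      by rewrite /p mulrC divfK ?gt_eqF.
    rewrite (powRM _ (ler0n _ 2) (ltW r0)) /b powRN -/T.
    by field; rewrite gt_eqF// powR_gt0.
  (* Taking the power [p = 1/q] turns the estimate into the hypothesis of the covering lemma. *)
  rewrite rE -lee_pdivrMl// -EFinM; case: I I0 => [I| |]// I0; last by rewrite leey.
  rewrite poweR_EFin !lee_fin => KI.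
  have -> : I = (I `^ q) `^ p by rewrite -powRrM qp powRr1.
  rewrite ge0_ler_powR ?(ltW p0) ?nnegrE ?powR_ge0//.
  by rewrite mulr_ge0 ?invr_ge0 ?(ltW A0) ?mulr_ge0 ?powR_ge0 ?(ltW K0) ?(ltW t0).
apply: (@le_trans _ _ (riesz_cap a s ((\bigcup_j N j) `|` G))).
  apply: le_riesz_cap => // x tx.
  by have [xN|xN] := pselect ((\bigcup_j N j) x); [left|right].
apply: le_trans (riesz_capU _ _ a0 an s0) _.
have W0 : (0 <= W)%E.
  by apply: nneseries_ge0 => j _ _; rewrite mule_ge0 ?energy_ge0// lee_fin ltW.
apply: (@le_trans _ _ ((C2 / T)%:E * W)%E).
  apply: le_trans (leeD capN capG) _; rewrite muleA -EFinM -ge0_muleDl ?lee_fin.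
  - rewrite -EFinD le_eqVlt; apply/orP; left; apply/eqP; congr (_%:E * _)%E.
    by rewrite /C2; field; rewrite !gt_eqF// powR_gt0.
  - by rewrite divr_ge0 ?powR_ge0// ltW// mulr_gt0// powR_gt0.
  - by rewrite mulr_ge0 ?powR_ge0// divr_ge0 ?(ltW Cc0)// ltW// mulr_gt0.
apply: le_trans (lee_wpmul2l _ WS) _; first by rewrite lee_fin ltW// divr_gt0.
have lT0 : (0 <= (l `^ p * T)%:E)%E by rewrite lee_fin ltW// mulr_gt0// powR_gt0.
have eE0 : (0 <= e%:E)%E by rewrite lee_fin ltW.
rewrite (ge0_muleDr _ (mule_ge0 lT0 S0) eE0) (muleA (C2 / T)%:E) -!EFinM.
rewrite (_ : C2 / T * (l `^ p * T) = C2 * l `^ p); last by field; rewrite gt_eqF.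
rewrite (_ : C2 / T * e = eps)//.
by rewrite /e; field; rewrite !gt_eqF.
Qed.

End dyadic_weak_type.

(** * Dilations of the half-line *)

Section scaling.
Context (R : realType).
Local Notation RT := (measurableTypeR R).
Local Notation mu := (@lebesgue_measure R).

Lemma measurable_scale (e : R) : measurable_fun [set: RT] (fun x : RT => e * x : RT).
Proof. exact: measurable_funM. Qed.

(** The image of [mu] under multiplication by [e], times [e], agrees with [mu] on half-open
    intervals and hence is [mu] by uniqueness. *)
Lemma integral_scale (h : R -> \bar R) (e : R) : 0 < e ->
  {homo h : u v / u <= v >-> (v <= u)%E} -> (forall u, 0 <= h u)%E ->
  (\int[mu]_(u in `]0%R, +oo[) h (e * u)%R =
    e^-1%:E * \int[mu]_(u in `]0%R, +oo[) h u)%E.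
Proof.
move=> e0 hmon h0.
pose P := pushforward_measure mu (measurable_scale e).
have e0' : 0 <= e by exact: ltW.
pose m := mscale (NngNum e0') P.
have muE (A : set RT) : measurable A -> mu A = m A.
  move=> mA; apply: (@lebesgue_measure_unique R m) => // X [[a b] /= _ <-].
  rewrite /m /mscale /= /P /= /pushforward.
  have -> : ((fun x : R => e * x) @^-1` [set` `]a, b]] = [set` `]e^-1 * a, e^-1 * b]])%R.
    apply/seteqP; split => x; rewrite /= !in_itv/=.
      by rewrite ltr_pdivrMl// ler_pdivlMl.
    by rewrite ltr_pdivrMl// ler_pdivlMl.
  rewrite [RHS](_ : _ = (e%:E * mu [set` `](e^-1 * a)%R, (e^-1 * b)%R]])%E)//.
  rewrite !lebesgue_measure_itv/= !lte_fin ltr_pM2l ?invr_gt0//.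
  case: ifPn => _; last by rewrite mule0.
  by rewrite -!EFinB -EFinM mulrBr !mulrA divff ?gt_eqF// !mul1r.
have mO : measurable ([set` `]0, +oo[] : set RT) by exact: measurable_itv.
have mh D : measurable (D : set RT) -> measurable_fun (D : set RT) h.
  by move=> mD; exact: nonincreasing_emeasurable.
rewrite [in RHS](eq_measure_integral m); last by move=> A mA _; exact: muE.
rewrite (ge0_integral_mscale _ mO _ (mh _ mO))//=.
rewrite muleA -EFinM mulVf ?gt_eqF// mul1e.
rewrite (ge0_integral_pushforward (measurable_scale e) mu mO (mh _ mO))//.
congr (integral _ _ _); apply/seteqP; split => x; rewrite /= !in_itv/= !andbT.
  by move=> x0; rewrite mulr_gt0.
by rewrite pmulr_rgt0.
Qed.

End scaling.

(** * From level sets to Choquet integrals *)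

Section maximal_choquet.
Context (R : realType) (n : nat) (c gamma alpha s : R).
Hypotheses (c0 : 0 < c) (gamma0 : 0 <= gamma) (ga : gamma < alpha).
Hypotheses (an : alpha < n%:R) (s1 : 1 < s) (asn : alpha * s < n%:R).
Local Notation V := 'rV[R]_n.
Local Notation p0 := ((n%:R - alpha * s) / (n%:R - gamma * s)).
Local Notation mu := (@lebesgue_measure R).
Implicit Types (D : set V) (f : V -> R).

Let s0 : 0 < s. Proof. exact: lt_trans s1. Qed.

(** This is the integrand of the Choquet integral of [|f|^p], named so that the layer-cake lemmas
    can be applied to it. *)
Definition level_cap p D f (u : R) : \bar R :=
  cap c alpha s [set x | D x /\ (u%:E < (`|f x| `^ p)%:E)%E].

Lemma level_cap_mono p D f : {homo level_cap p D f : u v / u <= v >-> (v <= u)%E}.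
Proof.
move=> u v uv; apply: le_cap => // x [Dx vx]; split => //.
by apply: le_lt_trans vx; rewrite lee_fin.
Qed.

Lemma level_cap_ge0 p D f u : (0 <= level_cap p D f u)%E.
Proof. exact: cap_ge0. Qed.

Lemma superlevel_cap p D f u : 0 < p -> 0 < u ->
  riesz_cap alpha s (superlevel D f u) = level_cap p D f (u `^ p).
Proof.
move=> p0' u0; have a0 : 0 < alpha by exact: le_lt_trans ga.
rewrite /level_cap cap_neq0E ?gt_eqF//; congr riesz_cap.
apply/seteqP; split => x [Dx ux]; split => //.
  by rewrite lte_fin gt0_ltr_powR ?nnegrE// ltW.
rewrite ltNge; apply/negP => xu; move: ux; rewrite lte_fin ltNge.
by rewrite ge0_ler_powR ?nnegrE ?(ltW p0') ?(ltW u0).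
Qed.

(** The exponent [p] only relabels the levels, from [l t 2^j] for [|f|] to their [p]-th powers for
    [|f|^p]; the weights keep the exponent [p0]. *)
Lemma cap_maximal_level p : 0 < p -> exists C l : R, [/\ 0 < C, 0 < l &
  forall D f t, 0 < t ->
  (cap c alpha s [set x : V | (t%:E < cap_maximal c gamma s D f x)%E] <=
   C%:E * \sum_(j <oo) (((2 ^+ j) `^ p0)%:E *
     level_cap p D f ((l * t) `^ p * (2 `^ p) ^+ j)%R))%E].
Proof.
move=> p_gt0; have a0 : 0 < alpha by exact: le_lt_trans ga.
have [C [l [C0 l0 H]]] := cap_maximal_dyadic c0 gamma0 ga an s1 asn.
exists C, l; split => // D f t t0; rewrite cap_neq0E ?gt_eqF//.
apply: le_trans (H D f t t0) _; rewrite le_eqVlt; apply/orP; left; apply/eqP.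
congr (_ * _)%E; apply: eq_eseriesr => j _; congr (_ * _)%E.
rewrite (superlevel_cap _ _ p_gt0) ?mulr_gt0 ?exprn_gt0// powRM ?mulr_ge0 ?exprn_ge0 ?(ltW l0) ?(ltW t0)//.
by rewrite powRX.
Qed.

Lemma cap_maximal_ge0 D f x : (0 <= cap_maximal c gamma s D f x)%E.
Proof.
apply: le_trans (ereal_sup_ubound (ex_intro2 _ _ 1 (ltr01 : 0 < 1) erefl)).
rewrite mule_ge0 ?inve_ge0 ?mule_ge0 ?cap_ge0 ?lee_fin ?powR_ge0//.
by apply: integral_ge0 => u _; exact: cap_ge0.
Qed.

(** At the critical exponent the weight [2^(j p0)] is the level itself divided by [(l t)^p0], so the
    sum is a lower Riemann sum and [layer_cake_ge] applies with ratio [2^p0]. *)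
Lemma choquet_maximal_weak : exists2 C : R, 0 < C & forall D f t, 0 < t ->
  (cap c alpha s [set x : V | (t%:E < cap_maximal c gamma s D f x)%E] <=
   (C / t `^ p0)%:E * choquet (cap c alpha s) D (fun x => (`|f x| `^ p0)%:E))%E.
Proof.
have gsn : gamma * s < n%:R by rewrite (lt_trans _ asn)// ltr_pM2r.
have p0_gt0 : 0 < p0 by rewrite divr_gt0// subr_gt0.
have [C [l [C0 l0 H]]] := cap_maximal_level p0_gt0.
pose th := 2 `^ p0 : R.
have th1 : 1 < th.
  by rewrite -[ltLHS](congr1 (@^~ p0) (powR1 R)) gt0_ltr_powR ?nnegrE ?ltr1n.
have th'0 : 0 < 1 - th^-1 by rewrite subr_gt0 invf_lt1// (lt_trans _ th1).
exists (C / l `^ p0 * (1 - th^-1)^-1).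
  by rewrite mulr_gt0 ?invr_gt0// divr_gt0// powR_gt0.
move=> D f t t0; apply: le_trans (H D f t t0) _.
set sg := (l * t) `^ p0; have sg0 : 0 < sg by rewrite powR_gt0// mulr_gt0.
have := layer_cake_ge sg0 th1 (@level_cap_mono p0 D f) (level_cap_ge0 p0 D f).
rewrite -/(choquet (cap c alpha s) D (fun x => (`|f x| `^ p0)%:E)).
set I := choquet _ _ _ => layer.
have -> : (C / l `^ p0 * (1 - th^-1)^-1 / t `^ p0)%:E = ((C / sg)%:E * (1 - th^-1)^-1%:E)%E.
  rewrite -EFinM /sg powRM ?(ltW l0) ?(ltW t0)//; congr EFin.
  by rewrite invfM mulrA mulrAC.
rewrite -muleA EFinM -[leRHS]muleA lee_wpmul2l ?lee_fin ?(ltW C0)//.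
rewrite -lee_pdivrMl ?invr_gt0// invrK; apply: le_trans layer.
rewrite -nneseriesZl; last first.
  by move=> j _; rewrite mule_ge0 ?level_cap_ge0// lee_fin powR_ge0.
apply: lee_nneseries => j _.
  by move=> _; rewrite !mule_ge0 ?level_cap_ge0 ?lee_fin ?powR_ge0.
by rewrite muleA -EFinM powRX.
Qed.

(** When the level estimate is integrated, the dilation in the [j]-th term yields [2^(- p j)]
    against the weight [2^(p0 j)]; the series converges because [p > p0]. *)
Lemma choquet_maximal_strong p : p0 < p -> exists2 C : R, 0 < C & forall D f,
  (choquet (cap c alpha s) setT (fun x : V => (cap_maximal c gamma s D f x `^ p)%E)
   <= C%:E * choquet (cap c alpha s) D (fun x => (`|f x| `^ p)%:E))%E.
Proof.
move=> p0p.
have gsn : gamma * s < n%:R by rewrite (lt_trans _ asn)// ltr_pM2r.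
have p0_gt0 : 0 < p0 by rewrite divr_gt0// subr_gt0.
have p_gt0 : 0 < p by exact: lt_trans p0p.
have [C [l [C0 l0 H]]] := cap_maximal_level p_gt0.
pose q := 2 `^ (p0 - p) : R.
have q0 : 0 <= q by exact: powR_ge0.
have q1 : q < 1 by rewrite powR2_lt1// subr_lt0.
have lp0 : 0 < l `^ p by rewrite powR_gt0.
exists (C * ((l `^ p)^-1 / (1 - q))).
  by rewrite mulr_gt0// divr_gt0 ?invr_gt0// subr_gt0.
move=> D f; rewrite [X in (_ <= _ * X)%E]/choquet.
pose h := level_cap p D f.
have hmon : {homo h : u v / u <= v >-> (v <= u)%E} by exact: level_cap_mono.
have h0 u : (0 <= h u)%E by exact: level_cap_ge0.
rewrite -/(level_cap p D f) -/h.
pose k (j : nat) : R := l `^ p * (2 `^ p) ^+ j.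
have k0 j : 0 < k j by rewrite mulr_gt0// exprn_gt0// powR_gt0.
pose F j u := (((2 ^+ j) `^ p0)%:E * h (k j * u)%R)%E.
have F0 j u : (0 <= F j u)%E by rewrite mule_ge0// lee_fin powR_ge0.
have hkmon j : {homo (fun u => h (k j * u)) : u v / u <= v >-> (v <= u)%E}.
  by move=> u v uv; apply: hmon; rewrite ler_wpM2l// ltW.
have mO : measurable ([set` `]0, +oo[] : set (measurableTypeR R)) by exact: measurable_itv.
have mhk j : measurable_fun ([set` `]0, +oo[] : set (measurableTypeR R)) (fun u => h (k j * u)).
  exact: nonincreasing_emeasurable.
have mF j : measurable_fun ([set` `]0, +oo[] : set (measurableTypeR R)) (F j).
  exact: measurable_funeM.
apply: (@le_trans _ _ (\int[mu]_(u in `]0%R, +oo[) (C%:E * \sum_(j <oo) F j u))%E).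
  rewrite /choquet; apply: (@ge0_le_integral _ _ R mu _ mO).
  - by move=> u _; exact: cap_ge0.
  - apply: nonincreasing_emeasurable => // u v uv; apply: le_cap => // x [_ vx]; split => //.
    by apply: le_lt_trans vx; rewrite lee_fin.
  - by apply: measurable_funeM; exact: ge0_emeasurable_sum.
  move=> u /=; rewrite in_itv/= andbT => u0.
  have up0 : 0 < u `^ p^-1 by rewrite powR_gt0.
  (* Level [u] of the [p]-th power is level [u^(1/p)] of the maximal function. *)
  apply: (@le_trans _ _ (cap c alpha s [set x : V | ((u `^ p^-1)%:E < cap_maximal c gamma s D f x)%E])).
    apply: le_cap => // x [_ ux] /=; rewrite ltNge; apply/negP => xu.
    move: ux; rewrite ltNge => /negP; apply.
    apply: le_trans (gt0_ler_poweR (ltW p_gt0) _ _ xu) _.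
    - by rewrite in_itv/= cap_maximal_ge0 leey.
    - by rewrite in_itv/= lee_fin powR_ge0 leey.
    - by rewrite poweR_EFin -powRrM mulVf ?gt_eqF// powRr1// ltW.
  apply: le_trans (H D f _ up0) _; rewrite le_eqVlt; apply/orP; left; apply/eqP.
  congr (_ * _)%E; apply: eq_eseriesr => j _; congr (_ * level_cap _ _ _ _)%E.
  rewrite powRM ?(ltW l0) ?(ltW up0)// -powRrM mulVf ?gt_eqF// powRr1 ?(ltW u0)//.
  by rewrite mulrAC.
rewrite ge0_integralZl//; last 3 first.
- exact: ge0_emeasurable_sum.
- by move=> u _; exact: nneseries_ge0.
- by rewrite lee_fin ltW.
rewrite integral_nneseries//.
rewrite EFinM -muleA lee_wpmul2l ?lee_fin ?(ltW C0)//.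
have I0 : (0 <= \int[mu]_(u in `]0%R, +oo[) h u)%E by exact: integral_ge0.
have -> : (\sum_(j <oo) \int[mu]_(u in `]0%R, +oo[) F j u =
    \sum_(j <oo) (((l `^ p)^-1 * q ^+ j)%:E * \int[mu]_(u in `]0%R, +oo[) h u))%E.
  apply: eq_eseriesr => j _; rewrite /F ge0_integralZl//.
  rewrite integral_scale// muleA -EFinM; congr (_%:E * _)%E.
  have -> : q = 2 `^ p0 / 2 `^ p by rewrite /q powRD ?pnatr_eq0 ?implybT// powRN.
  by rewrite powRX// /k invfM mulrCA expr_div_n.
case: (\int[mu]_(u in _) h u)%E I0 => [I| |]// I0; last first.
  by rewrite gt0_muley ?leey// lte_fin divr_gt0 ?invr_gt0// subr_gt0.
rewrite (eq_eseriesr (g := fun j => (I%:E * ((l `^ p)^-1 * q ^+ j)%:E)%E)); last first.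
  by move=> j _; rewrite muleC.
rewrite nneseriesZl; last by move=> j _; rewrite lee_fin mulr_ge0 ?exprn_ge0// invr_ge0 powR_ge0.
by rewrite nneseries_geometric ?invr_ge0 ?powR_ge0// muleC.
Qed.

End maximal_choquet.

Theorem corollary1p8 (R : realType) (n : nat) (c gamma alpha s p : R)
    (hc : 0 < c) (hgamma : 0 <= gamma) (hga : gamma < alpha)
    (halpha : alpha < n%:R) (hs1 : 1 < s) (hsn : s < n%:R / alpha)
    (hp : (n%:R - alpha * s) / (n%:R - gamma * s) <= p) :
  ((n%:R - alpha * s) / (n%:R - gamma * s) < p ->
     exists2 C : R, 0 < C &
       forall (D : set 'rV[R]_n) (f : 'rV[R]_n -> R),
         Lp_cap (cap c alpha s) p D f ->
         (choquet (cap c alpha s) setT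
            (fun x => (cap_maximal c gamma s D f x `^ p)%E)
          <= C%:E * choquet (cap c alpha s) D
                      (fun x => (`|f x| `^ p)%:E))%E)
  /\
  (p = (n%:R - alpha * s) / (n%:R - gamma * s) ->
     exists2 C : R, 0 < C &
       forall (D : set 'rV[R]_n) (f : 'rV[R]_n -> R),
         Lp_cap (cap c alpha s) p D f ->
         forall t : R, 0 < t ->
         (cap c alpha s [set x | t%:E < cap_maximal c gamma s D f x]
          <= (C / t `^ p)%:E * choquet (cap c alpha s) D
                                 (fun x => (`|f x| `^ p)%:E))%E).
Proof.
have a0 : 0 < alpha by exact: le_lt_trans hga.
have asn : alpha * s < n%:R by rewrite mulrC -ltr_pdivlMr.
split=> [p0p|->].
  have [C C0 HC] := choquet_maximal_strong hc hgamma hga halpha hs1 asn p0p.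
  by exists C => // D f _; exact: HC.
have [C C0 HC] := choquet_maximal_weak hc hgamma hga halpha hs1 asn.
by exists C => // D f _ t t0; exact: HC.
Qed.
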